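(* Let $\mathbb{S}^1$ act on a unital $C^*$-algebra $A$, and let $\gamma$ denote a generator of the dual group $\widehat{\mathbb{S}^1}\cong\mathbb{Z}$. Then $$\mathrm{dim}^{\mathbb{S}^1}_{\mathrm{LT}}(A)=\min\Big\{n\in\mathbb{N}:\exists\text{ normal }a_0,\ldots,a_n\in A_\gamma\text{ such that }\sum_{i=0}^na_ia_i^*=1\Big\},$$ $$\mathrm{dim}^{\mathbb{S}^1}_{\mathrm{WLT}}(A)=\min\Big\{n\in\mathbb{N}:\exists\text{ normal }a_0,\ldots,a_n\in A_\gamma\text{ such that }\sum_{i=0}^na_ia_i^*\text{ is invertible}\Big\},$$ and $$\mathrm{dim}^{\mathbb{S}^1}_{\mathrm{SLT}}(A)=\min\Big\{n\in\mathbb{N}:\exists\text{ normal, pairwise commuting }a_0,\ldots,a_n\in A_\gamma\text{ such that }\sum_{i=0}^na_ia_i^*=1\Big\}.$$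
   Context: $\mathbb{N}$ includes $0$, and the minimum of the empty set is $\infty$. For an action $\alpha$ of a compact abelian group $G$ on $A$ and a character $\lambda\in\widehat G$, the spectral subspace is $A_\lambda=\{a\in A:\alpha_g(a)=\lambda(g)a\text{ for all }g\in G\}$. Local-triviality dimensions: let a compact group $G$ act on a unital $C^*$-algebra $A$. Equip $C(G)$ with $(\alpha_gf)(h)=f(hg)$ and $C_0((0,1])\otimes C(G)$ with the action on the second factor, and let $t$ be the identity function in $C_0((0,1])$. The plain dimension $\mathrm{dim}^G_{\mathrm{LT}}(A)$ (resp. weak dimension $\mathrm{dim}^G_{\mathrm{WLT}}(A)$) is the smallest $n\ge0$ for which there exist $G$-equivariant $*$-homomorphisms $\rho_0,\ldots,\rho_n:C_0((0,1])\otimes C(G)\to A$ such that $\sum_{i=0}^n\rho_i(t\otimes1)$ equals $1$ (resp. is invertible). The strong dimension $\mathrm{dim}^G_{\mathrm{SLT}}(A)$ is the smallest $n\ge 0$ for which there is a $G$-equivariant unital $*$-homomorphism $C(E_nG)\to A$, where $E_0G=G$, $E_{n+1}G=E_nG*G$ (topological join) with the diagonal action of $G$. If no such $n$ exists, the dimension is $\infty$. *)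

(* Defs.v *)
From HB Require Import structures.
From mathcomp Require Import all_boot all_order all_algebra complex.
From mathcomp Require Import all_classical all_reals all_analysis.

Set Implicit Arguments.
Unset Strict Implicit.
Unset Printing Implicit Defensive.

Import Order.TTheory GRing.Theory Num.Theory.
Import numFieldNormedType.Exports.

Local Open Scope classical_set_scope.
Local Open Scope quotient_scope.
Local Open Scope ring_scope.

(* The complex field, packed as a numClosedFieldType because MathComp-Analysis
   attaches the norm topology to abstract numeric fields, not to R[i]. *)
Definition Cx (R : realType) : numClosedFieldType := R[i].

(* Common ancestor of CStarAlgebra and TopologicalGroup, required by HB; it does
   not ask for continuity of the product. *)
HB.structure Definition TopologicalSpaceMonoid := {M of Topological M & Monoid M}.

(* Unital C*-algebras (the zero algebra is allowed). The product and the unit are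
   those of a monoidType, i.e. a * b and 1 in group_scope: the algebraic and the
   normed-module hierarchies of the libraries have no join that could host both
   a ring and a normed-module structure on an arbitrary type. *)
HB.mixin Record isCStarAlgebra (R : realType) A
    of CompleteNormedModule (Cx R) A & Monoid A := {
  cmulDl : forall a b c : A, ((a + b)%R * c)%g = (a * c)%g + (b * c)%g;
  cmulDr : forall a b c : A, (a * (b + c)%R)%g = (a * b)%g + (a * c)%g;
  cscaleAl : forall (k : Cx R) (a b : A), k *: (a * b)%g = ((k *: a)%R * b)%g;
  cscaleAr : forall (k : Cx R) (a b : A), k *: (a * b)%g = (a * (k *: b)%R)%g;
  cnormM : forall a b : A, `|(a * b)%g| <= `|a| * `|b| :> Cx R;
  star : A -> A;
  starK : involutive star;
  starD : forall a b : A, star (a + b) = star a + star b;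
  starZ : forall (k : Cx R) (a : A), star (k *: a) = k^* *: star a;
  starM : forall a b : A, star (a * b)%g = (star b * star a)%g;
  cstar_identity : forall a : A, `|(star a * a)%g| = `|a| ^+ 2 :> Cx R }.

#[short(type="cstarAlgType")]
HB.structure Definition CStarAlgebra (R : realType) :=
  {A of CompleteNormedModule (Cx R) A & Monoid A & isCStarAlgebra R A}.

HB.mixin Record isTopologicalGroup G of Group G & Topological G := {
  mulg_continuous : continuous (fun p : G * G => (p.1 * p.2)%g);
  invg_continuous : continuous (fun g : G => (g^-1)%g) }.

#[short(type="topGroupType")]
HB.structure Definition TopologicalGroup :=
  {G of Group G & Topological G & isTopologicalGroup G}.

Section Elements.
Variables (R : realType) (A : cstarAlgType R).

Definition normal (a : A) : Prop := (star a * a = a * star a)%g.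

Definition invertible (a : A) : Prop :=
  exists b : A, (b * a)%g = 1%g /\ (a * b)%g = 1%g.

End Elements.

Section Actions.
Variables (R : realType) (G : topGroupType) (A : cstarAlgType R).

Record cstar_action := CStarAction {
  act :> G -> A -> A;
  act1 : forall a, act 1%g a = a;
  actM : forall g h a, act (g * h)%g a = act g (act h a);
  act_add : forall g a b, act g (a + b) = act g a + act g b;
  act_scale : forall g (c : Cx R) a, act g (c *: a) = c *: act g a;
  act_one : forall g, act g 1%g = 1%g;
  act_mul : forall g a b, act g (a * b)%g = (act g a * act g b)%g;
  act_star : forall g a, act g (star a) = star (act g a);
  act_continuous : forall a, continuous (act ^~ a) }.

End Actions.

Section Circle.
Variable R : realType.

Definition circle : Type := set_type [set z : Cx R | `|z| = 1].

HB.instance Definition _ := Choice.on circle.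
HB.instance Definition _ := SubType.on circle.
HB.instance Definition _ := Topological.on circle.

Lemma circle_norm (z : circle) : `|\val z| = 1 :> Cx R.
Proof. by case: z => z /= /set_mem. Qed.

Lemma circle_neq0 (z : circle) : \val z != 0 :> Cx R.
Proof. by rewrite -normr_gt0 circle_norm ltr01. Qed.

Definition mk_circle (z : Cx R) (hz : `|z| = 1) : circle :=
  exist _ z (mem_set hz).

Lemma circle1_subproof : `|1 : Cx R| = 1. Proof. exact: normr1. Qed.
Lemma circleM_subproof (z w : circle) : `|\val z * \val w : Cx R| = 1.
Proof. by rewrite normrM !circle_norm mulr1. Qed.
Lemma circleV_subproof (z : circle) : `|(\val z)^-1 : Cx R| = 1.
Proof. by rewrite normfV circle_norm invr1. Qed.

Definition circle_one := mk_circle circle1_subproof.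
Definition circle_mul z w := mk_circle (circleM_subproof z w).
Definition circle_inv z := mk_circle (circleV_subproof z).

Lemma circle_mulA : associative circle_mul.
Proof. by move=> x y z; apply: val_inj; rewrite /= mulrA. Qed.
Lemma circle_mul1 : left_id circle_one circle_mul.
Proof. by move=> x; apply: val_inj; rewrite /= mul1r. Qed.
Lemma circle_mulr1 : right_id circle_one circle_mul.
Proof. by move=> x; apply: val_inj; rewrite /= mulr1. Qed.
Lemma circle_mulV : left_inverse circle_one circle_inv circle_mul.
Proof. by move=> x; apply: val_inj; rewrite /= mulVf ?circle_neq0. Qed.
Lemma circle_mulrV : right_inverse circle_one circle_inv circle_mul.
Proof. by move=> x; apply: val_inj; rewrite /= mulfV ?circle_neq0. Qed.

HB.instance Definition _ := isGroup.Build circle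
  circle_mulA circle_mul1 circle_mulr1 circle_mulV circle_mulrV.

Lemma circle_val_continuous : continuous (\val : circle -> Cx R).
Proof. exact: initial_continuous. Qed.

Lemma Cx_continuousM (X : topologicalType) (f h : X -> Cx R) :
  continuous f -> continuous h -> continuous (fun x => f x * h x).
Proof. by move=> cf ch x; apply: continuousM; [exact: cf | exact: ch]. Qed.

Lemma circle_mul_continuous :
  continuous (fun p : circle * circle => (p.1 * p.2)%g).
Proof.
suff h : continuous
    ((\val : circle -> Cx R) \o (fun p : circle * circle => (p.1 * p.2)%g)).
  exact: (continuous_comp_initial h).
have h1 : continuous (fun p : circle * circle => \val p.1 : Cx R).
  by move=> p; apply: cvg_comp; [exact: cvg_fst | exact: circle_val_continuous].
have h2 : continuous (fun p : circle * circle => \val p.2 : Cx R).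
  by move=> p; apply: cvg_comp; [exact: cvg_snd | exact: circle_val_continuous].
exact: (Cx_continuousM h1 h2).
Qed.

Lemma circle_inv_continuous : continuous (fun z : circle => (z^-1)%g).
Proof.
suff h : continuous
    ((\val : circle -> Cx R) \o (fun z : circle => (z^-1)%g)).
  exact: (continuous_comp_initial h).
move=> z.
exact: (continuousV (circle_neq0 z) (@circle_val_continuous z)).
Qed.

HB.instance Definition _ := isTopologicalGroup.Build circle
  circle_mul_continuous circle_inv_continuous.

End Circle.

Section Characters.
Variables (R : realType) (G : topGroupType).

Definition is_character (chi : G -> circle R) : Prop :=
  continuous chi /\ forall g h, chi (g * h)%g = (chi g * chi h)%g.

Definition dual_generator (gamma : G -> circle R) : Prop :=
  is_character gamma /\
  forall chi, is_character chi ->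
    exists k : int, forall g, \val (chi g) = \val (gamma g) ^ k :> Cx R.

Definition spectral_subspace (A : cstarAlgType R) (alpha : cstar_action G A)
    (lambda : G -> circle R) : set A :=
  [set a | forall g, alpha g a = \val (lambda g) *: a].

End Characters.

(* C*-algebras of functions on a set X are represented as sets of functions,
   with the pointwise operations; [star_hom D rho] only looks at [rho] on [D]. *)
Section FunctionAlgebras.
Variable R : realType.
Local Notation C := (Cx R).

Definition Cont (X : topologicalType) : set (X -> C) := [set f | continuous f].

(* Continuous functions vanishing at infinity. *)
Definition Cont0 (X : topologicalType) : set (X -> C) :=
  [set f | continuous f /\
    forall e : R, 0 < e -> exists2 K : set X, compact K &
      forall x, ~ K x -> `|f x| < e%:C%C].

(* The C*-tensor product of D and E: the closure, in the sup norm, of the span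
   of the elementary tensors (x, y) |-> u x * v y. This is the spatial tensor
   product for D and E acting by multiplication on l^2(X) and l^2(Y), and the
   C*-norm on the algebraic tensor product is unique as D, E are commutative. *)
Definition tensor (X Y : Type) (D : set (X -> C)) (E : set (Y -> C)) :
    set (X * Y -> C) :=
  [set f | forall e : R, 0 < e ->
    exists n (u : 'I_n -> X -> C) (v : 'I_n -> Y -> C),
      (forall i, D (u i) /\ E (v i)) /\
      (forall p, `|f p - \sum_i u i p.1 * v i p.2| <= e%:C%C)].

Definition star_hom (X : Type) (D : set (X -> C)) (A : cstarAlgType R)
    (rho : (X -> C) -> A) : Prop :=
  [/\ forall f h, D f -> D h -> rho (fun x => f x + h x) = rho f + rho h,
      forall c f, D f -> rho (fun x => c * f x) = c *: rho f,
      forall f h, D f -> D h -> rho (fun x => f x * h x) = (rho f * rho h)%g &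
      forall f, D f -> rho (fun x => (f x)^*) = star (rho f)].

(* Equivariance, where the action of g on functions is f |-> f \o tau g. *)
Definition equivariant (X : Type) (G : topGroupType) (tau : G -> X -> X)
    (D : set (X -> C)) (A : cstarAlgType R) (alpha : cstar_action G A)
    (rho : (X -> C) -> A) : Prop :=
  forall g f, D f -> rho (f \o tau g) = alpha g (rho f).

End FunctionAlgebras.

(* +oo when P is empty. *)
Definition min_set (P : set nat) : \bar nat :=
  if pselect (exists n, `[< P n >]) is left exP
  then EFin (ex_minn exP) else +oo%E.

(* The dimensions are meant for compact G. *)
Section LocalTriviality.
Variables (R : realType) (G : topGroupType) (A : cstarAlgType R).
Variable alpha : cstar_action G A.

Definition half_open : topologicalType := [set` `]0, (1 : R)]%R] : set R.

(* C_0((0,1]) (x) C(G) *)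
Definition cone_alg : set (half_open * G -> Cx R) :=
  tensor (@Cont0 R half_open) (@Cont R G).

Definition cone_translate (g : G) (p : half_open * G) : half_open * G :=
  (p.1, (p.2 * g)%g).

Definition cone_t : half_open * G -> Cx R := fun p => (\val p.1)%:C%C.

Definition cone_hom (rho : (half_open * G -> Cx R) -> A) : Prop :=
  star_hom cone_alg rho /\ equivariant cone_translate cone_alg alpha rho.

Definition dim_LT : \bar nat := min_set [set n |
  exists rho : 'I_n.+1 -> (half_open * G -> Cx R) -> A,
    (forall i, cone_hom (rho i)) /\ \sum_i rho i cone_t = 1%g].

Definition dim_WLT : \bar nat := min_set [set n |
  exists rho : 'I_n.+1 -> (half_open * G -> Cx R) -> A,
    (forall i, cone_hom (rho i)) /\ invertible (\sum_i rho i cone_t)].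

End LocalTriviality.

Section Join.
Variable R : realType.

Definition unit_itv : topologicalType := [set` `[0, (1 : R)]%R] : set R.

Section Relation.
Variables X Y : topologicalType.

(* (x, y, 0) ~ (x', y, 0) and (x, y, 1) ~ (x, y', 1) *)
Definition join_rel0 : rel (X * Y * unit_itv) := fun p q =>
  [&& p.2 == q.2,
      (\val p.2 == 0) || (p.1.1 == q.1.1) &
      (\val p.2 == 1) || (p.1.2 == q.1.2)].

Lemma join_rel_refl : reflexive join_rel0.
Proof. by move=> p; rewrite /join_rel0 !eqxx !orbT. Qed.

Lemma join_rel_sym : symmetric join_rel0.
Proof.
move=> p q; rewrite /join_rel0 (eq_sym q.2) (eq_sym q.1.1) (eq_sym q.1.2).
by case: eqP => //= ->.
Qed.

Lemma join_rel_trans : transitive join_rel0.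
Proof.
move=> q p r /and3P[/eqP pq h1 h2] /and3P[/eqP qr h3 h4].
rewrite /join_rel0 -qr pq eqxx /=; rewrite -pq in h3 h4 *.
apply/andP; split.
  by case/orP: h1 => [->//|/eqP ->].
by case/orP: h2 => [->//|/eqP ->].
Qed.

Definition join_rel := EquivRel _ join_rel_refl join_rel_sym join_rel_trans.

Definition join : Type := {eq_quot join_rel}.

HB.instance Definition _ := Topological.copy join (quotient_topology join).
HB.instance Definition _ := Quotient.on join.

End Relation.

Variable G : topGroupType.

Record Gspace := MkGspace {
  Gspace_sort :> topologicalType;
  Gspace_act : G -> Gspace_sort -> Gspace_sort }.

(* Diagonal action, computed on representatives. *)
Definition join_act (X Y : Gspace) (g : G) (z : join X Y) : join X Y :=
  \pi_(join X Y)%qT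
    (Gspace_act g (repr z).1.1, Gspace_act g (repr z).1.2, (repr z).2).

Definition Gtranslate : Gspace := @MkGspace G (fun g h => (h * g)%g).

Fixpoint EG (n : nat) : Gspace :=
  if n is m.+1 then @MkGspace (join (EG m) Gtranslate) (@join_act _ _)
  else Gtranslate.

End Join.

Definition dim_SLT (R : realType) (G : topGroupType) (A : cstarAlgType R)
    (alpha : cstar_action G A) : \bar nat := min_set [set n |
  exists phi : (EG R G n -> Cx R) -> A,
    [/\ star_hom (@Cont R (EG R G n)) phi,
        phi (fun=> 1) = 1%g &
        equivariant (@Gspace_act G (EG R G n)) (@Cont R (EG R G n)) alpha phi]].

(* Main.v *)
(* Evaluating an equivariant homomorphism at sqrt t (x) gamma (at the join
   coordinates of E_n S^1 for the strong dimension) gives the elements a_i.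
   Conversely the homomorphisms are f |-> f(a), a functional calculus built without
   Gelfand theory. In a commutative C*-algebra B, positivity of h means
   |t - h| <= t for some t; square roots come from a fixed-point iteration, and s^2
   is positive because s + i sqrt(1 - s^2) is unitary. For commuting contractions
   a_j, averaging N independent copies of a one-step distribution with weights in B
   and mean a gives finitely supported positive B-valued distributions P with
   sum_z |z - a|^2 P(z) = V / N; f(a) is the limit of sum_z f(z) P(z), after the
   points z are retracted onto the sphere or the ball. This applies to functions f
   on X pulled back along k : X -> C^m as soon as |f x - f y| <= e + K |k x - k y|^2,
   which compactness of X provides, with X = [0, 1] x S^1 or X = E_n S^1.
   If the a_i are normal and commute and sum_i a_i a_i^* = 1, then a_i also commutes
   with a_j^*: the commutators d_ij = [a_j^*, a_i] satisfy d_ij^* = d_ji and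
   sum_ij d_ij^* d_ij = 0. *)

Require Import Defs.
From HB Require Import structures.
From mathcomp Require Import all_boot all_order all_algebra.
From mathcomp Require Import complex.
From mathcomp Require Import all_classical all_reals all_analysis.
From mathcomp Require Import ring lra.
Local Open Scope classical_set_scope.
Local Open Scope ring_scope.

Set Implicit Arguments.
Unset Strict Implicit.
Unset Printing Implicit Defensive.

Import Order.TTheory GRing.Theory Num.Theory.
Import numFieldNormedType.Exports.

(** * Positivity in commutative C*-algebras *)

(** The obstacle is that nothing in [B] may be checked pointwise on a spectrum. The decisive
    inequalities therefore come from algebraic identities that write a difference as a combination,
    with positive coefficients, of terms [y* y]. This is why errors are measured by squared
    distances: these have a [B]-valued form, and the parallelogram identity replaces the triangle
    inequality. Independence does the work of a spectral measure. Comparing two approximations, or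
    the sum for [f g] with the product of the sums for [f] and [g], produces one double sum of
    differences against product weights, which the two variances bound. Averaging shrinks the
    variance but leaves the points off the sphere or ball, where [f] is undefined; hence the
    retraction, at the price of a factor 4 in the variance. For the plain and weak dimensions the
    [a_i] need not commute with each other: the calculus is applied to each [a_i] separately, and
    sums of positive elements are handled in [A] by the norm form of positivity, which survives
    addition without commutation. *)

Section CommutativeCstar.
Variable R : realType.
Local Notation C := (Cx R).

Definition modulus (c : C) : R := complex.Re `|c|.

(* A plain record over [comPzRingType]: the zero algebra is allowed, and [ring]
   applies, with scalars and adjoints as ring morphisms. *)
Record ccstar := CCstar {
  cring :> comPzRingType;
  csc : {rmorphism C -> cring};
  cadj : {rmorphism cring -> cring};
  cnm : cring -> R;
  cadjK : involutive cadj;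
  cadj_sc : forall c, cadj (csc c) = csc c^*;
  cnm_ge0 : forall x, 0 <= cnm x;
  cnm_eq0 : forall x, cnm x = 0 -> x = 0;
  cnmD : forall x y, cnm (x + y) <= cnm x + cnm y;
  cnmM : forall x y, cnm (x * y) <= cnm x * cnm y;
  cnm_sc : forall c x, cnm (csc c * x) = modulus c * cnm x;
  cnm_st : forall x, cnm (cadj x * x) = cnm x ^+ 2;
  ccomplete : forall u : nat -> cring,
    (forall e : R, 0 < e -> exists N, forall m n, (N <= m)%N -> (N <= n)%N ->
       cnm (u m - u n) <= e) ->
    exists l, forall e : R, 0 < e -> exists N, forall n, (N <= n)%N ->
       cnm (u n - l) <= e }.

Variable B : ccstar.
Local Notation sc := (@csc B).
Local Notation st := (@cadj B).
Local Notation nm := (@cnm B).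
Local Notation rs t := (csc B (t%:C)%C).
Implicit Types (x y h s : B) (t : R).

Lemma modulus_real t : modulus (t%:C)%C = `|t|.
Proof. by rewrite /modulus normc_def /= expr0n addr0 sqrtr_sqr. Qed.

Lemma modulusE (c : C) : `|c| = ((modulus c)%:C)%C.
Proof. by rewrite /modulus normc_def. Qed.

Lemma st_rs t : st (rs t) = rs t.
Proof. by rewrite cadj_sc conj_Creal // complex_real. Qed.

Lemma half2 : 2 * rs 2^-1 = 1.
Proof.
by rewrite -(rmorph_nat sc 2) -(rmorph_nat (@real_complex R)) -!rmorphM mulfV // !rmorph1.
Qed.

Lemma nm_rs t x : nm (rs t * x) = `|t| * nm x.
Proof. by rewrite cnm_sc modulus_real. Qed.

Lemma nm0 : nm 0 = 0.
Proof. by rewrite -(mulr0 (rs 0)) nm_rs normr0 mul0r. Qed.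

Lemma nmN x : nm (- x) = nm x.
Proof.
have -> : - x = rs (-1) * x by ring.
by rewrite nm_rs normrN1 mul1r.
Qed.

Lemma nmB x y : nm (x - y) = nm (y - x).
Proof. by rewrite -nmN opprB. Qed.

Lemma nm1_le : nm 1 <= 1.
Proof.
have := cnm_st (1 : B); rewrite rmorph1 mulr1 => h.
have := cnm_ge0 (1 : B); nra.
Qed.

Lemma nm_rs1 t : nm (rs t) <= `|t|.
Proof. by rewrite -[rs t]mulr1 nm_rs ler_piMr // nm1_le. Qed.

Lemma nm_star x : nm (st x) = nm x.
Proof.
suff le y : nm y <= nm (st y).
  by apply/eqP; rewrite eq_le le -{2}(cadjK x) le.
have := cnmM (st y) y; rewrite cnm_st expr2.
have := cnm_ge0 y; have := cnm_ge0 (st y) => h1.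
rewrite le_eqVlt => /orP[/eqP <-//|h2].
by rewrite ler_pM2r.
Qed.

Lemma nm_eq x y : (forall e : R, 0 < e -> nm (x - y) <= e) -> x = y.
Proof.
move=> h; apply/eqP; rewrite -subr_eq0; apply/eqP/cnm_eq0.
apply/eqP; rewrite eq_le cnm_ge0 andbT.
by apply/ler_addgt0Pr => e e0; rewrite add0r h.
Qed.

Lemma nm_tri x y z : nm (x - z) <= nm (x - y) + nm (y - z).
Proof. by rewrite -[x - z](subrKA y) cnmD. Qed.

Definition sa x := st x = x.

Lemma saD x y : sa x -> sa y -> sa (x + y).
Proof. by rewrite /sa rmorphD => -> ->. Qed.
Lemma saN x : sa x -> sa (- x).
Proof. by rewrite /sa rmorphN => ->. Qed.
Lemma saM x y : sa x -> sa y -> sa (x * y).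
Proof. by rewrite /sa rmorphM => -> ->. Qed.
Lemma sars t : sa (rs t).
Proof. exact: st_rs. Qed.
Lemma sa1 : sa 1.
Proof. exact: rmorph1. Qed.

Lemma nm_sq x : sa x -> nm (x * x) = nm x ^+ 2.
Proof. by move=> h; rewrite -cnm_st h. Qed.

(* Iteration of [w |-> (x + w^2) / 2], whose fixed points satisfy
   [(1 - w)^2 = 1 - x], dominated by the same iteration for the scalar [1]. *)
Section SquareRoot.
Variable x : B.
Hypotheses (sax : sa x) (nx : nm x <= 1).

Fixpoint sqit n : B :=
  if n is m.+1 then rs 2^-1 * (x + sqit m * sqit m) else 0.
Fixpoint sqit1 n : R :=
  if n is m.+1 then 2^-1 * (1 + sqit1 m * sqit1 m) else 0.

Lemma sqitS n : sqit n.+1 = rs 2^-1 * (x + sqit n * sqit n).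
Proof. by []. Qed.
Lemma sqit1S n : sqit1 n.+1 = 2^-1 * (1 + sqit1 n * sqit1 n).
Proof. by []. Qed.

Lemma sqit1_bounds n : 0 <= sqit1 n <= 1.
Proof. by elim: n => [|n /andP[h1 h2]] /=; nra. Qed.

(** The gap [g = 1 - sqit1 n] evolves by [g - g^2 / 2], hence decays like [2 / n]. *)
Lemma sqit1_rate n : 1 - sqit1 n <= 2 / n.+2%:R.
Proof.
elim: n => [|n] /=; first by lra.
have /andP[] := sqit1_bounds n.
set r := sqit1 n => r0 r1 h.
have n0 : (0 : R) <= n%:R by [].
move: h; rewrite -(@natr1 R n.+2) -(@natr1 R n.+1) -(@natr1 R n).
set N : R := n%:R in n0 *.
rewrite !ler_pdivlMr; [|lra|lra] => h.
(* The map [g - g^2 / 2] increases on [0, 1]: up to a positive factor, [hq] compares its values at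
   the bound [2 / (N + 2)] and at the gap [1 - r]. *)
have hq : 0 <= (2 - (1 - r) * (N + 1 + 1)) * (2 - (1 - r) - 2 / (N + 2)).
  apply: mulr_ge0; first lra.
  have : 2 / (N + 2) <= 1 by rewrite ler_pdivrMr; lra.
  by lra.
have e : 2 / (N + 2) * (N + 2) = 2 by rewrite divfK //; lra.
nra.
Qed.

Lemma sqit_le n : nm (sqit n) <= sqit1 n.
Proof.
elim: n => [|n h] /=; first by rewrite nm0.
rewrite nm_rs ger0_norm ?invr_ge0 // ler_pM2l ?invr_gt0 //.
apply: le_trans (cnmD _ _) _; apply: lerD => //.
by apply: le_trans (cnmM _ _) _; apply: ler_pM; rewrite ?cnm_ge0.
Qed.

Lemma sqit_step n : nm (sqit n.+1 - sqit n) <= sqit1 n.+1 - sqit1 n.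
Proof.
elim: n => [|n h]; first by rewrite subr0 subr0; exact: (sqit_le 1).
have -> : sqit n.+2 - sqit n.+1 =
    rs 2^-1 * ((sqit n.+1 - sqit n) * (sqit n.+1 + sqit n)).
  by rewrite [sqit n.+2]sqitS {3}sqitS; ring.
have -> : sqit1 n.+2 - sqit1 n.+1 =
    2^-1 * ((sqit1 n.+1 - sqit1 n) * (sqit1 n.+1 + sqit1 n)).
  by rewrite [sqit1 n.+2]sqit1S {3}sqit1S; ring.
rewrite nm_rs ger0_norm ?invr_ge0 // ler_pM2l ?invr_gt0 //.
apply: le_trans (cnmM _ _) _; apply: ler_pM; rewrite ?cnm_ge0 //.
by apply: le_trans (cnmD _ _) _; apply: lerD; exact: sqit_le.
Qed.

Lemma sqit_cauchy m n : (n <= m)%N -> nm (sqit m - sqit n) <= 2 / n.+2%:R.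
Proof.
move=> nm'; apply: (@le_trans _ _ (sqit1 m - sqit1 n)); last first.
  have /andP[_ h] := sqit1_bounds m; have := sqit1_rate n.
  by move: (2 / _) => q; lra.
rewrite -(subnK nm'); elim: (m - n)%N => [|p h]; first by rewrite !subrr nm0.
rewrite addSn; apply: le_trans (nm_tri _ (sqit (p + n)) _) _.
have := sqit_step (p + n); lra.
Qed.

Lemma sqrt_ex : exists2 s, sa s & s * s = 1 - x.
Proof.
have small (e : R) : 0 < e -> exists N, 2 / N.+2%:R <= e.
  move=> e0; exists (Num.bound (2 / e)).
  rewrite ler_pdivrMr // mulrC -ler_pdivrMr //.
  apply/ltW/(lt_trans (archi_boundP _)); last by rewrite ltr_nat.
  by rewrite divr_ge0 // ltW.
have [|l hl] := @ccomplete B sqit.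
  move=> e /small[N hN]; exists N => m n.
  wlog le_mn : m n / (n <= m)%N => [hw|] hm hn.
    by case/orP: (leq_total n m) => h; [|rewrite nmB]; apply: hw.
  apply: le_trans (sqit_cauchy le_mn) (le_trans _ hN).
  by rewrite ler_pM2l // lef_pV2 ?posrE // ler_nat.
have near (e : R) : 0 < e -> exists n, nm (sqit n - l) <= e /\ nm (sqit n.+1 - l) <= e.
  by move=> /hl[N hN]; exists N; split; apply: hN.
have saw n : sa (sqit n).
  elim: n => [|n h]; first exact: rmorph0.
  by apply: saM; [exact: sars|apply: saD => //; exact: saM].
have sal : sa l.
  apply: nm_eq => e e0; have [|n [h _]] := near (2^-1 * e); first lra.
  apply: le_trans (nm_tri _ (sqit n) _) _.
  by rewrite -{1}(saw n) -rmorphB nm_star [nm (l - _)]nmB; lra.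
have fix_l : l = rs 2^-1 * (x + l * l).
  apply: nm_eq => e e0.
  (* As [nm (sqit n + l) <= 2 + d <= 3], the two errors add up to at most [d + 3 d / 2 <= e]. *)
  set d := Num.min 1 (e / 4).
  have d0 : 0 < d by rewrite /d lt_min ltr01; lra.
  have d1 : d <= 1 by rewrite /d ge_min lexx.
  have de : d <= e / 4 by rewrite /d ge_min lexx orbT.
  have [n [h1 h2]] := near d d0.
  apply: le_trans (nm_tri _ (sqit n.+1) _) _; rewrite nmB.
  have -> : sqit n.+1 - rs 2^-1 * (x + l * l) =
     rs 2^-1 * ((sqit n - l) * (sqit n + l)) by rewrite /=; ring.
  have h3 : nm (sqit n + l) <= 2 + d.
    have -> : sqit n + l = (sqit n + sqit n) + (l - sqit n) by ring.
    have /andP[_ b1] := sqit1_bounds n; have b2 := sqit_le n.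
    have b3 := cnmD (sqit n) (sqit n).
    by apply: le_trans (cnmD _ _) _; rewrite nmB; lra.
  rewrite nm_rs ger0_norm ?invr_ge0 //.
  have h4 := cnmM (sqit n - l) (sqit n + l).
  have h5 : nm (sqit n - l) * nm (sqit n + l) <= d * (2 + d).
    by apply: ler_pM => //; exact: cnm_ge0.
  have : d * (2 + d) <= 3 * d by nra.
  by lra.
exists (1 - l); first exact: saD sa1 (saN sal).
have -> : (1 - l) * (1 - l) = 1 - (2 * l - l * l) by ring.
by rewrite {1}fix_l mulrA half2; ring.
Qed.
End SquareRoot.

(** * Positive elements and their square roots *)

Definition pos h := sa h /\ exists t, nm (rs t - h) <= t.

Lemma posD h k : pos h -> pos k -> pos (h + k).
Proof.
move=> [sh [t ht]] [sk [u hu]]; split; first exact: saD.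
exists (t + u); have -> : rs (t + u) - (h + k) = (rs t - h) + (rs u - k) by ring.
by apply: le_trans (cnmD _ _) _; exact: lerD.
Qed.

Lemma pos_rs t : 0 <= t -> pos (rs t).
Proof. by move=> t0; split; [exact: sars|exists t; rewrite subrr nm0]. Qed.

Lemma pos1 : pos 1.
Proof. by rewrite -(rmorph1 sc) -(rmorph1 (@real_complex R)); exact: pos_rs. Qed.
Lemma pos0 : pos 0.
Proof. by rewrite -(rmorph0 sc) -(rmorph0 (@real_complex R)); exact: pos_rs. Qed.

Lemma posZ t h : 0 <= t -> pos h -> pos (rs t * h).
Proof.
move=> t0 [sh [u hu]]; split; first exact: saM (sars _) sh.
exists (t * u); have -> : rs (t * u) - rs t * h = rs t * (rs u - h) by ring.
by rewrite nm_rs ger0_norm // ler_wpM2l.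
Qed.

Lemma pos_sum (I : finType) (F : I -> B) : (forall i, pos (F i)) -> pos (\sum_i F i).
Proof. by move=> h; apply: big_ind => //; [exact: pos0|exact: posD]. Qed.

Lemma pos_near h t : sa h -> nm h <= t -> pos (rs t - h) /\ pos (rs t + h).
Proof.
move=> sh ht; split; split.
- exact: saD (sars _) (saN sh).
- by exists t; rewrite opprB addrC subrK.
- exact: saD (sars _) sh.
- by exists t; rewrite opprD addrA subrr add0r nmN.
Qed.

(** Positivity with bound [t > 0] says that [1 - h / t] is a contraction, so [sqrt_ex] gives a root
    of [h / t], to be rescaled by the square root of [t]. If [t = 0], then [h = 0]. *)
Lemma pos_sqrt h : pos h -> exists2 s, sa s & h = s * s.
Proof.
move=> [sh [t ht]].
have : 0 <= t by apply: le_trans (cnm_ge0 _) ht.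
rewrite le_eqVlt => /orP[/eqP t0|t0].
  exists 0; first exact: rmorph0.
  have : rs t - h = 0.
    by apply: cnm_eq0; apply/eqP; rewrite eq_le cnm_ge0 andbT t0.
  by rewrite -t0 !rmorph0 sub0r mulr0 => /eqP; rewrite oppr_eq0 => /eqP.
have [||s ss e] := @sqrt_ex (1 - rs t^-1 * h).
- by apply: saD sa1 (saN (saM (sars _) sh)).
- have -> : 1 - rs t^-1 * h = rs t^-1 * (rs t - h).
    have : rs t^-1 * rs t = 1 by rewrite -!rmorphM mulVf ?lt0r_neq0 // !rmorph1.
    by move=> e; ring: e.
  rewrite nm_rs ger0_norm; last by rewrite invr_ge0 ltW.
  by rewrite mulrC ler_pdivrMr ?mul1r.
exists (rs (Num.sqrt t) * s); first exact: saM (sars _) ss.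
have -> : rs (Num.sqrt t) * s * (rs (Num.sqrt t) * s) = rs (Num.sqrt t ^+ 2) * (s * s).
  by ring.
rewrite e sqr_sqrtr ?ltW //.
have : rs t * rs t^-1 = 1 by rewrite -!rmorphM mulfV ?lt0r_neq0 // !rmorph1.
by move=> e'; ring: e'.
Qed.

Local Notation im := (sc ('i)%C).

Lemma im_sq : im * im = -1.
Proof. by rewrite -rmorphM -expr2 sqr_i rmorphN1. Qed.

Lemma st_im : st im = - im.
Proof.
rewrite cadj_sc -rmorphN; congr (sc _).
by apply/eqP; rewrite eq_complex /= oppr0 !eqxx.
Qed.

(** The element [u = s + i r] satisfies [u* u = M], and [s] is its real part, so [nm s <= nm u] and
    [nm u ^ 2 <= M]. *)
Lemma sum_sq_le M s r : 0 <= M -> sa s -> sa r -> s * s + r * r = rs M -> nm (s * s) <= M.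
Proof.
move=> M0 ss sr e; set u := s + im * r.
have su : st u = s - im * r by rewrite rmorphD rmorphM ss sr st_im mulNr.
have uu : st u * u = rs M.
  rewrite su /u -e; have h := im_sq.
  have -> : (s - im * r) * (s + im * r) = s * s - im * im * (r * r) by ring.
  by rewrite h; ring.
have u2 : nm u ^+ 2 <= `|M| by rewrite -cnm_st uu nm_rs1.
have : s = rs 2^-1 * (u + st u).
  rewrite su /u; have -> : s + im * r + (s - im * r) = 2 * s by ring.
  by rewrite mulrA [rs _ * 2]mulrC half2 mul1r.
move/(congr1 nm); rewrite nm_rs ger0_norm ?invr_ge0 // => h.
have := cnmD u (st u); rewrite nm_star => h2.
have hs : nm s <= nm u by lra.
have n0 := cnm_ge0 s.
rewrite ger0_norm // in u2; rewrite nm_sq //; nra.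
Qed.
End CommutativeCstar.

(** * Approximate joint spectral measures *)

Section JointCalculus.
Variables (R : realType) (B : ccstar R).
Local Notation C := (Cx R).
Local Notation sc := (@csc R B).
Local Notation st := (@cadj R B).
Local Notation nm := (@cnm R B).
Local Notation rs t := (csc B (t%:C)%C).
Local Notation im := (sc ('i)%C).
Implicit Types (x y h s : B) (t : R).

(** Rescale [s] to [s1] of norm 1 and let [r^2 = 1 - s1^2]. Then [sum_sq_le] gives
    [nm (1 - s1^2) <= 1], which is positivity of [s1^2] with bound 1. *)
Lemma pos_sq s : sa s -> pos (s * s).
Proof.
move=> ss; have := cnm_ge0 s; rewrite le_eqVlt => /orP[/eqP/esym/cnm_eq0 ->|t0].
  by rewrite mulr0; exact: pos0.
set t := nm s in t0; set s1 := rs t^-1 * s.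
have e1 : rs t * rs t^-1 = 1 by rewrite -!rmorphM mulfV ?lt0r_neq0 // !rmorph1.
have es : s * s = rs (t ^+ 2) * (s1 * s1).
  rewrite /s1; have -> : rs (t ^+ 2) * (rs t^-1 * s * (rs t^-1 * s)) =
    (rs t * rs t^-1) * (rs t * rs t^-1) * (s * s) by ring.
  by rewrite e1 !mul1r.
have ss1 : sa s1 by exact: saM (sars _ _) ss.
have n1 : nm s1 = 1.
  by rewrite nm_rs ger0_norm ?invr_ge0 1?ltW // mulVf ?lt0r_neq0.
have s11 : sa (s1 * s1) by exact: saM.
have [||r sr er] := @sqrt_ex _ _ (s1 * s1) => //.
  by rewrite nm_sq // n1 expr1n.
have ler : nm (r * r) <= 1.
  by apply: (@sum_sq_le _ _ 1 r s1) => //; rewrite er subrK !rmorph1.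
rewrite es; apply: posZ; first exact: sqr_ge0.
by split => //; exists 1; rewrite !rmorph1 -er.
Qed.

Lemma posM h k : pos h -> pos k -> pos (h * k).
Proof.
move=> /pos_sqrt[s ss ->] /pos_sqrt[r sr ->]; rewrite mulrACA.
by apply: pos_sq; exact: saM.
Qed.

Lemma sa_ReIm y : exists b c, [/\ sa b, sa c & y = b + im * c].
Proof.
exists (rs 2^-1 * (y + st y)), (- im * (rs 2^-1 * (y - st y))); split.
- by rewrite /sa rmorphM rmorphD cadjK st_rs addrC.
- by rewrite /sa !rmorphM rmorphB rmorphN st_im cadjK st_rs; ring.
- have -> : rs 2^-1 * (y + st y) + im * (- im * (rs 2^-1 * (y - st y))) =
    rs 2^-1 * (y + st y) - (im * im) * (rs 2^-1 * (y - st y)) by ring.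
  rewrite im_sq.
  have -> : rs 2^-1 * (y + st y) - -1 * (rs 2^-1 * (y - st y)) = 2 * rs 2^-1 * y by ring.
  by rewrite half2 mul1r.
Qed.

Lemma pos_st y : pos (st y * y).
Proof.
have [b [c [sb sc' ->]]] := sa_ReIm y.
rewrite rmorphD rmorphM sb sc' st_im.
have -> : (b + - im * c) * (b + im * c) = b * b - im * im * (c * c) by ring.
rewrite im_sq mulN1r opprK; apply: posD; exact: pos_sq.
Qed.

Lemma nm_le_pos M h : 0 <= M -> pos h -> pos (rs M - h) -> nm h <= M.
Proof.
move=> M0 /pos_sqrt[s ss ->] /pos_sqrt[r sr e].
by apply: (sum_sq_le M0 ss sr); rewrite -e addrC subrK.
Qed.

Lemma nm_mono h g : pos h -> pos (g - h) -> nm h <= nm g.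
Proof.
move=> ph pgh; apply: nm_le_pos => //; first exact: cnm_ge0.
have sg : sa g by rewrite -[g](subrK h); apply: saD; [case: pgh|case: ph].
have [pg _] := pos_near sg (lexx _).
by rewrite -[_ - h](subrKA g); exact: posD.
Qed.

Lemma nm_abs M x : 0 <= M -> sa x -> pos (rs M - x) -> pos (rs M + x) -> nm x <= M.
Proof.
move=> M0 sx p1 p2; suff : nm x ^+ 2 <= M ^+ 2.
  by rewrite ler_pXn2r // nnegrE ?cnm_ge0.
rewrite -nm_sq //; apply: nm_le_pos; rewrite ?sqr_ge0 //; first exact: pos_sq.
have -> : rs (M ^+ 2) - x * x = (rs M - x) * (rs M + x) by ring.
exact: posM.
Qed.

Lemma modulus_ReIm (c : C) :
  `|complex.Re c| <= modulus c /\ `|complex.Im c| <= modulus c.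
Proof.
case: c => a b; rewrite /modulus normc_def /= -!sqrtr_sqr; split;
apply: ler_wsqrtr; have := sqr_ge0 a; have := sqr_ge0 b; lra.
Qed.

Lemma nm_comb_real (I : finType) (P : I -> B) (c d : I -> R) :
  (forall i, pos (P i)) -> (forall i, `|c i| <= d i) ->
  nm (\sum_i rs (c i) * P i) <= nm (\sum_i rs (d i) * P i).
Proof.
move=> pP cd; set D := \sum_i rs (d i) * P i.
have d0 i : 0 <= d i by apply: le_trans (cd i).
have pD : pos D by apply: pos_sum => i; exact: posZ.
have [pD' _] := pos_near pD.1 (lexx _).
apply: nm_abs; first exact: cnm_ge0.
- rewrite /sa rmorph_sum; apply: eq_bigr => i _; rewrite rmorphM st_rs.
  by have [-> _] := pP i.
- rewrite -[_ - _](subrKA D); apply: posD => //; rewrite -sumrB; apply: pos_sum => i.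
  have -> : rs (d i) * P i - rs (c i) * P i = rs (d i - c i) * P i by ring.
  by apply: posZ => //; have := cd i; rewrite ler_norml => /andP[]; lra.
- rewrite -[_ + _](subrKA D); apply: posD => //; rewrite -big_split.
  apply: pos_sum => i /=.
  have -> : rs (d i) * P i + rs (c i) * P i = rs (d i + c i) * P i by ring.
  by apply: posZ => //; have := cd i; rewrite ler_norml => /andP[]; lra.
Qed.

(* The factor [2] comes from treating the real and imaginary parts separately. *)
Lemma nm_comb (I : finType) (P : I -> B) (c : I -> C) (d : I -> R) :
  (forall i, pos (P i)) -> (forall i, modulus (c i) <= d i) ->
  nm (\sum_i sc (c i) * P i) <= 2 * nm (\sum_i rs (d i) * P i).
Proof.
move=> pP cd.
have -> : \sum_i sc (c i) * P i = \sum_i rs (complex.Re (c i)) * P i +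
    im * \sum_i rs (complex.Im (c i)) * P i.
  rewrite mulr_sumr -big_split; apply: eq_bigr => i _ /=.
  by rewrite {1}[c i]complexE rmorphD rmorphM; ring.
have mi : modulus ('i%C : C) = 1.
  by rewrite /modulus normc_def /= expr0n expr1n add0r sqrtr1.
apply: le_trans (cnmD _ _) _; rewrite cnm_sc mi mul1r mulr2n mulrDl mul1r.
by apply: lerD; apply: nm_comb_real => // i; have [h1 h2] := modulus_ReIm (c i);
  apply: le_trans (cd i).
Qed.

Lemma sum_prod (I L : finType) (F : I -> B) (G : L -> B) :
  \sum_(p : I * L) F p.1 * G p.2 = (\sum_i F i) * (\sum_l G l).
Proof. by rewrite big_distrlr /= pair_bigA. Qed.

Lemma sum_prod1 (I L : finType) (F : I -> B) (Q : L -> B) :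
  \sum_l Q l = 1 -> \sum_(p : I * L) F p.1 * Q p.2 = \sum_i F i.
Proof. by move=> h; rewrite sum_prod h mulr1. Qed.

Lemma sum_prod2 (I L : finType) (P : I -> B) (G : L -> B) :
  \sum_i P i = 1 -> \sum_(p : I * L) P p.1 * G p.2 = \sum_l G l.
Proof. by move=> h; rewrite sum_prod h mul1r. Qed.

(** Variances of independent variables add: both cross terms contain the mean of [v] or its adjoint
    as a factor, and [v] is centred. *)
Lemma variance_add (I L : finType) (u P : I -> B) (v Q : L -> B) :
  (forall l, pos (Q l)) ->
  \sum_i P i = 1 -> \sum_l Q l = 1 -> \sum_l v l * Q l = 0 ->
  \sum_(p : I * L) st (u p.1 + v p.2) * (u p.1 + v p.2) * (P p.1 * Q p.2) =
  \sum_i st (u i) * u i * P i + \sum_l st (v l) * v l * Q l.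
Proof.
move=> pQ P1 Q1 vQ.
have vQ' : \sum_l st (v l) * Q l = 0.
  have := congr1 st vQ; rewrite rmorph0 rmorph_sum => h; rewrite -[RHS]h.
  by apply: eq_bigr => l _; rewrite rmorphM; have [-> _] := pQ l.
rewrite (eq_bigr (fun p : I * L => (st (u p.1) * u p.1 * P p.1) * Q p.2 +
    (st (u p.1) * P p.1) * (v p.2 * Q p.2) +
    (u p.1 * P p.1) * (st (v p.2) * Q p.2) + P p.1 * (st (v p.2) * v p.2 * Q p.2))).
  rewrite !big_split /= (sum_prod1 (fun i => st (u i) * u i * P i) Q1).
  rewrite (sum_prod (fun i => st (u i) * P i) (fun l => v l * Q l)) vQ mulr0 addr0.
  rewrite (sum_prod (fun i => u i * P i) (fun l => st (v l) * Q l)) vQ' mulr0 addr0.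
  by rewrite (sum_prod2 (fun l => st (v l) * v l * Q l) P1).
by move=> p _; rewrite rmorphD; ring.
Qed.

Section Systems.
Variables (m : nat) (a : 'I_m.+1 -> B).
Hypothesis na : forall j, nm (a j) <= 1.
Implicit Types (z w : 'I_m.+1 -> C).

Definition dist2 (b : 'I_m.+1 -> B) z : B :=
  \sum_j st (sc (z j) - b j) * (sc (z j) - b j).

Lemma pos_dist2 b z : pos (dist2 b z).
Proof. by apply: pos_sum => j; exact: pos_st. Qed.

Let rp x := rs 2^-1 * (x + st x).
(** The real part of [x] for [true], its imaginary part for [false]. *)
Let comp (b : bool) x := rp (if b then x else - im * x).
Let sg (c : bool) : R := if c then -1 else 1.

Lemma modulusi : modulus ('i%C : C) = 1.
Proof. by rewrite /modulus normc_def /= expr0n expr1n add0r sqrtr1. Qed.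

Lemma compE x : comp true x + im * comp false x = x.
Proof.
rewrite /comp /rp rmorphM rmorphN st_im.
have -> : rs 2^-1 * (x + st x) + im * (rs 2^-1 * (- im * x + - - im * st x)) =
  rs 2^-1 * (x + st x) + im * im * (rs 2^-1 * (st x - x)) by ring.
rewrite im_sq.
have -> : rs 2^-1 * (x + st x) + -1 * (rs 2^-1 * (st x - x)) = 2 * rs 2^-1 * x by ring.
by rewrite half2 mul1r.
Qed.

Lemma sa_comp b x : sa (comp b x).
Proof. by rewrite /sa /comp /rp rmorphM rmorphD cadjK st_rs addrC. Qed.

Lemma nm_comp b x : nm (comp b x) <= nm x.
Proof.
rewrite /comp /rp nm_rs ger0_norm ?invr_ge0 //.
set y := (if b then _ else _).
have -> : nm x = nm y.
  by rewrite /y; case: b {y} => //; rewrite mulNr nmN cnm_sc modulusi mul1r.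
by have := cnmD y (st y); rewrite nm_star; lra.
Qed.

(* A one-step distribution with mean [a]: a coordinate [j], then the real or the
   imaginary axis, are chosen uniformly, then a sign with weights [(1 +- h) / 2],
   where [h] is the corresponding component of [a j]. *)
Lemma one_step_system : exists (I : finType) (z : I -> 'I_m.+1 -> C) (P : I -> B),
  [/\ forall i, pos (P i), \sum_i P i = 1 &
      forall j, \sum_i sc (z i j) * P i = a j].
Proof.
(* [K] normalises the [4 (m + 1)] atoms. A given coordinate and axis is chosen with probability
   [1 / (2 (m + 1))], so atoms of height [T] restore the mean. *)
pose K : R := (4 * m.+1%:R)^-1; pose T : R := 2 * m.+1%:R.
exists ('I_m.+1 * (bool * bool))%type,
  (fun i l => if l == i.1 then ((T * sg i.2.2)%:C)%C * (if i.2.1 then 1 else 'i%C) else 0),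
  (fun i => rs K * (1 + rs (sg i.2.2) * comp i.2.1 (a i.1))).
have K0 : 0 <= K by rewrite invr_ge0 mulr_ge0.
have KT : 4 * rs K * m.+1%:R = 1.
  rewrite -(rmorph_nat sc 4) -(rmorph_nat sc m.+1) -!(rmorph_nat (@real_complex R)).
  by rewrite -!rmorphM mulrAC mulfV ?rmorph1 // mulf_neq0.
split => [[j [b c]]||j].
- apply: posZ => //=.
  have hn : nm (comp b (a j)) <= 1 by apply: le_trans (nm_comp _ _) _.
  have [] := pos_near (sa_comp b (a j)) hn.
  by rewrite /sg; case: c; rewrite ?rmorphN !rmorph1 ?mulN1r ?mul1r.
- rewrite -(pair_bigA _ (fun j p => rs K * (1 + rs (sg p.2) * comp p.1 (a j)))) /=.
  rewrite (eq_bigr (fun=> 4 * rs K)).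
    by rewrite sumr_const card_ord -[_ *+ m.+1]mulr_natr.
  move=> j _; rewrite -(pair_bigA _ (fun b c => rs K * (1 + rs (sg c) * comp b (a j)))) /=.
  by rewrite !big_bool /= ?rmorphN ?rmorph1; ring.
- rewrite -(pair_bigA _ (fun l p => sc (if j == l then ((T * sg p.2)%:C)%C *
     (if p.1 then 1 else 'i%C) else 0) * (rs K * (1 + rs (sg p.2) * comp p.1 (a l))))) /=.
  rewrite (bigD1 j) //= [X in _ + X]big1 => [|l lj]; last first.
    by rewrite big1 // => p _; rewrite eq_sym (negbTE lj) rmorph0 mul0r.
  rewrite addr0 eqxx -(pair_bigA _ (fun b c => sc (((T * sg c)%:C)%C *
    (if b then 1 else 'i%C)) * (rs K * (1 + rs (sg c) * comp b (a j))))) /=.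
  rewrite !big_bool /sg /= !mulr1 !mulrN1 !(rmorphM sc) !rmorphN !rmorph1 /=.
  rewrite -[RHS](compE (a j)) -[RHS]mul1r -[X in _ = X * _]KT /T.
  set p := comp true _; set q := comp false _.
  ring.
Qed.

(** Induction on [N], adding one independent copy of the one-step distribution, of variance [V],
    each time. Dividing the points by [N] afterwards turns the variance [N V] into [V / N]. *)
Lemma average_systems : exists V : B, forall N,
  exists (I : finType) (z : I -> 'I_m.+1 -> C) (P : I -> B),
  [/\ forall i, pos (P i), \sum_i P i = 1,
      forall j, \sum_i sc (z i j) * P i = N%:R * a j &
      \sum_i dist2 (fun j => N%:R * a j) (z i) * P i = N%:R * V].
Proof.
have [I1 [z1 [P1 [pP1 sP1 mP1]]]] := one_step_system.
exists (\sum_i dist2 a (z1 i) * P1 i); elim=> [|N [I [z [P [pP sP mP vP]]]]].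
  exists unit, (fun _ _ => 0), (fun=> 1); split => [_||j|]; first exact: pos1.
  - by rewrite big_const card_unit /= addr0.
  - by rewrite big1 ?mul0r // => i _; rewrite rmorph0 mul0r.
  - rewrite mul0r big1 // => i _; rewrite /dist2 big1 ?mul0r // => j _.
    by rewrite rmorph0 mul0r subrr mulr0.
exists (I * I1)%type, (fun p j => z p.1 j + z1 p.2 j), (fun p => P p.1 * P1 p.2); split.
- by move=> p; exact: posM.
- by rewrite sum_prod sP sP1 mul1r.
- move=> j; rewrite (eq_bigr (fun p : I * I1 => sc (z p.1 j) * P p.1 * P1 p.2 +
    P p.1 * (sc (z1 p.2 j) * P1 p.2))); last by move=> p _; rewrite rmorphD; ring.
  rewrite big_split /= (sum_prod1 (fun i => sc (z i j) * P i) sP1).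
  rewrite (sum_prod2 (fun l => sc (z1 l j) * P1 l) sP) mP mP1.
  by rewrite -[N.+1%:R]natr1; ring.
- have E (J : finType) (w : J -> 'I_m.+1 -> C) (b : 'I_m.+1 -> B) (Q : J -> B) :
    \sum_i dist2 b (w i) * Q i =
    \sum_j \sum_i st (sc (w i j) - b j) * (sc (w i j) - b j) * Q i.
    rewrite exchange_big; apply: eq_bigr => i _.
    by rewrite /dist2 mulr_suml.
  rewrite -natr1 mulrDl mul1r -vP !E -big_split /=; apply: eq_bigr => j _.
  rewrite -(@variance_add _ _ (fun i => sc (z i j) - N%:R * a j) P
    (fun l => sc (z1 l j) - a j) P1) //.
    apply: eq_bigr => p _; congr (st _ * _ * _); rewrite ?rmorphD; ring.
  rewrite (eq_bigr (fun l => sc (z1 l j) * P1 l - a j * P1 l)) => [|l _]; last by ring.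
  by rewrite sumrB -mulr_sumr sP1 mP1 mulr1 subrr.
Qed.

Variables (X : Type) (k : X -> 'I_m.+1 -> C).
(** The constant 4 is that of scalars: if [a] lies in the image of [k] and [k x] is the image point
    nearest to [z], then [|k x - a| <= 2 |z - a|]. *)
Hypothesis retract : forall z, exists x : X, pos (4 * dist2 a z - dist2 a (k x)).
Hypothesis k_bound : forall (x : X) j, modulus (k x j) <= 1.

(* A finitely supported approximation of the joint spectral measure of [a],
   transported to [X]. *)
Definition spectral_approx (eta : R) (I : finType) (x : I -> X) (P : I -> B) : Prop :=
  [/\ forall i, pos (P i), \sum_i P i = 1 &
      nm (\sum_i dist2 a (k (x i)) * P i) <= eta].

Lemma spectral_approx_ex eta : 0 < eta ->
  exists (I : finType) (x : I -> X) (P : I -> B), spectral_approx eta x P.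
Proof.
move=> eta0; have [V hV] := average_systems.
have [r hr] := choice retract.
(* Averaging leaves the variance [V / N], and the retraction multiplies it by 4: [N] makes
   [4 * nm V / N <= eta]. *)
pose N := (Num.bound (4 * nm V / eta)).+1.
have [I [z [P [pP sP _ vP]]]] := hV N.
have N0 : (0 : R) < N%:R by [].
pose w i j := (((N%:R^-1 : R))%:C)%C * z i j.
have dw i : dist2 a (w i) = rs (N%:R^-1 ^+ 2) * dist2 (fun j => N%:R * a j) (z i).
  rewrite /dist2 mulr_sumr; apply: eq_bigr => j _.
  have -> : sc (w i j) - a j = rs N%:R^-1 * (sc (z i j) - N%:R * a j).
    rewrite mulrBr mulrA -(rmorph_nat sc) -(rmorph_nat (@real_complex R)).
    by rewrite -!rmorphM mulVf ?lt0r_neq0 // !rmorph1 mul1r.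
  by rewrite rmorphM st_rs; ring.
exists I, (fun i => r (w i)), P; split => //.
apply: (@le_trans _ _ (nm (\sum_i 4 * dist2 a (w i) * P i))).
  apply: nm_mono.
    by apply: pos_sum => i; apply: posM => //; exact: pos_dist2.
  rewrite -sumrB; apply: pos_sum => i; rewrite -mulrBl; apply: posM => //.
rewrite (eq_bigr (fun i => rs (4 * N%:R^-1 ^+ 2) * (dist2 (fun j => N%:R * a j) (z i) * P i))).
  rewrite -mulr_sumr vP.
  have -> : rs (4 * N%:R^-1 ^+ 2) * (N%:R * V) = rs (4 * N%:R^-1) * V.
    rewrite mulrA -(rmorph_nat sc) -(rmorph_nat (@real_complex R)) -!rmorphM.
    by rewrite expr2 -!mulrA mulVf ?lt0r_neq0 // mulr1.
  rewrite nm_rs ger0_norm ?mulr_ge0 ?invr_ge0 ?ler0n // mulrAC.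
  rewrite ler_pdivrMr // [eta * _]mulrC -ler_pdivrMr //.
  apply/ltW/(lt_trans (archi_boundP _)); last by rewrite ltr_nat.
  by rewrite divr_ge0 ?mulr_ge0 ?cnm_ge0 // ltW.
by move=> i _; rewrite dw -(rmorph_nat sc) -(rmorph_nat (@real_complex R)); ring.
Qed.

(** * Functional calculus as a limit over approximations of small variance *)

Definition sqdist z w : R := \sum_j modulus (z j - w j) ^+ 2.

Lemma modulus_ge0 (c : C) : 0 <= modulus c.
Proof. by rewrite -(ler0c (modulus c)) -modulusE normr_ge0. Qed.

Lemma sqdist_ge0 z w : 0 <= sqdist z w.
Proof. by apply: sumr_ge0 => j _; exact: sqr_ge0. Qed.

Lemma rs_modulus (c : C) : rs (modulus c ^+ 2) = st (sc c) * sc c.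
Proof. by rewrite cadj_sc -rmorphM -normCKC modulusE rmorphXn. Qed.

(** Parallelogram identity: the difference is [|z + w - 2 a|^2]. *)
Lemma sqdist_dist2 z w :
  pos (2 * (dist2 a z + dist2 a w) - rs (sqdist z w)).
Proof.
rewrite /dist2 /sqdist -big_split /= mulr_sumr !rmorph_sum -sumrB.
apply: pos_sum => j; rewrite rs_modulus [sc (z j - w j)]rmorphB.
set u := sc (z j); set v := sc (w j).
have -> : 2 * (st (u - a j) * (u - a j) + st (v - a j) * (v - a j)) -
  st (u - v) * (u - v) = st (u + v - 2 * a j) * (u + v - 2 * a j) by ring.
exact: pos_st.
Qed.

(** The two samples are independent, so [sqdist_dist2] integrates to [2 (d + d')]; the outer factor
    2 comes from [nm_comb]. *)
Lemma spectral_approx_comb (e K d d' : R) (c : X -> X -> C)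
    (I L : finType) (x : I -> X) (y : L -> X) P Q :
  0 <= e -> 0 <= K ->
  (forall p q, modulus (c p q) <= e + K * sqdist (k p) (k q)) ->
  spectral_approx d x P -> spectral_approx d' y Q ->
  nm (\sum_(p : I * L) sc (c (x p.1) (y p.2)) * (P p.1 * Q p.2)) <=
  2 * (e + K * (2 * (d + d'))).
Proof.
move=> e0 K0 cK [pP sP dP] [pQ sQ dQ].
have pPQ (p : I * L) : pos (P p.1 * Q p.2) by exact: posM.
apply: le_trans (nm_comb pPQ (fun p => cK (x p.1) (y p.2))) _.
rewrite ler_pM2l //.
rewrite (eq_bigr (fun p : I * L => rs e * (P p.1 * Q p.2) +
   rs K * (rs (sqdist (k (x p.1)) (k (y p.2))) * (P p.1 * Q p.2)))); last first.
  by move=> p _; ring.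
rewrite big_split -!mulr_sumr /= sum_prod sP sQ mulr1 mulr1.
apply: le_trans (cnmD _ _) _; apply: lerD.
  by apply: le_trans (nm_rs1 _ _) _; rewrite ger0_norm.
rewrite nm_rs ger0_norm // ler_wpM2l //.
apply: (@le_trans _ _ (nm (\sum_(p : I * L) 2 * (dist2 a (k (x p.1)) + dist2 a (k (y p.2))) * (P p.1 * Q p.2)))).
  apply: nm_mono.
    by apply: pos_sum => p; apply: posM => //; apply: pos_rs; exact: sqdist_ge0.
  rewrite -sumrB; apply: pos_sum => p; rewrite -mulrBl; apply: posM => //.
  exact: sqdist_dist2.
rewrite (eq_bigr (fun p : I * L => 2 * (dist2 a (k (x p.1)) * P p.1 * Q p.2 +
   P p.1 * (dist2 a (k (y p.2)) * Q p.2)))); last by move=> p _; ring.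
rewrite -mulr_sumr big_split /=.
rewrite (sum_prod1 (fun i => dist2 a (k (x i)) * P i) sQ).
rewrite (sum_prod2 (fun l => dist2 a (k (y l)) * Q l) sP).
rewrite -(rmorph_nat sc) -(rmorph_nat (@real_complex R)) nm_rs ger0_norm //.
by rewrite ler_pM2l //; apply: le_trans (cnmD _ _) _; exact: lerD.
Qed.

(** Uniform continuity of [f] as a function of [k], with a quadratic bound so that integration
    against two samples involves second moments only. In particular [f] depends on its argument
    through [k] alone. *)
Definition admissible (f : X -> C) : Prop := forall e : R, 0 < e ->
  exists2 K : R, 0 <= K &
    forall p q, modulus (f p - f q) <= e + K * sqdist (k p) (k q).

Lemma modulusD (c d : C) : modulus (c + d) <= modulus c + modulus d.
Proof. by rewrite -lecR rmorphD -!modulusE ler_normD. Qed.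

Lemma modulusM (c d : C) : modulus (c * d) = modulus c * modulus d.
Proof.
have : ((modulus (c * d))%:C)%C = ((modulus c * modulus d)%:C)%C :> C.
  by rewrite rmorphM -!modulusE normrM.
by move=> /(@complexI R).
Qed.

Lemma modulus_conj (c : C) : modulus c^* = modulus c.
Proof. by rewrite /modulus norm_conjC. Qed.

Lemma admissible_bound f : admissible f -> exists2 M, 0 <= M & forall p, modulus (f p) <= M.
Proof.
move=> /(_ 1 ltr01)[K K0 hK]; have [x0 _] := retract (fun=> 0).
exists (modulus (f x0) + (1 + K * (m.+1%:R * 4))).
  by rewrite !addr_ge0 ?modulus_ge0 ?mulr_ge0.
move=> p; rewrite -[f p](subrK (f x0)) addrC; apply: le_trans (modulusD _ _) _.
rewrite lerD2l; apply: le_trans (hK _ _) _; rewrite lerD2l ler_wpM2l //.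
apply: (@le_trans _ _ (\sum_(j < m.+1) 4)); last by rewrite sumr_const card_ord mulr_natl.
apply: ler_sum => j _; have := modulusD (k p j) (- k x0 j).
have := k_bound p j; have := k_bound x0 j.
have -> : modulus (- k x0 j) = modulus (k x0 j) by rewrite /modulus normrN.
have := modulus_ge0 (k p j - k x0 j); nra.
Qed.

(** The limit is over all approximations of small variance, not along one sequence: two functions
    can be compared on a common approximation, and an approximation can be transported by an
    automorphism. *)
Definition calc (f : X -> C) (b : B) : Prop := forall e : R, 0 < e ->
  exists2 d : R, 0 < d & forall (I : finType) (x : I -> X) P,
    spectral_approx d x P -> nm (\sum_i sc (f (x i)) * P i - b) <= e.

Lemma spectral_approx_le (d d' : R) (I : finType) (x : I -> X) P :
  d <= d' -> spectral_approx d x P -> spectral_approx d' x P.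
Proof. by move=> dd [h1 h2 h3]; split => //; exact: le_trans dd. Qed.

Lemma admissible_cauchy f e : admissible f -> 0 < e ->
  exists2 d : R, 0 < d & forall (I L : finType) (x : I -> X) (y : L -> X) P Q,
    spectral_approx d x P -> spectral_approx d y Q ->
    nm (\sum_i sc (f (x i)) * P i - \sum_l sc (f (y l)) * Q l) <= e.
Proof.
move=> af e0; have e4 : 0 < e / 4 by lra.
have [K K0 hK] := af _ e4; have K1 : 0 < K + 1 by lra.
(* With both variances at most [d], the bound is [2 (e / 4 + 4 K d)], and this [d] gives
   [4 K d <= e / 4], also when [K = 0]. *)
exists (e / 16 / (K + 1)); first by rewrite !divr_gt0.
move=> I L x y P Q sx sy.
have -> : \sum_i sc (f (x i)) * P i - \sum_l sc (f (y l)) * Q l =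
    \sum_(p : I * L) sc (f (x p.1) - f (y p.2)) * (P p.1 * Q p.2).
  have [_ sP _] := sx; have [_ sQ _] := sy.
  rewrite -(sum_prod1 (fun i => sc (f (x i)) * P i) sQ).
  rewrite -(sum_prod2 (fun l => sc (f (y l)) * Q l) sP) -sumrB.
  by apply: eq_bigr => p _; rewrite rmorphB; ring.
apply: le_trans (spectral_approx_comb (ltW e4) K0 hK sx sy) _.
set d := _ / (K + 1); have -> : 2 * (d + d) = 4 * d by ring.
have : K * (4 * d) <= e / 4.
  have -> : K * (4 * d) = K / (K + 1) * (e / 4).
    by rewrite /d; field; lra.
  apply: ler_piMl; first exact: ltW.
  by rewrite ler_pdivrMr //; lra.
by lra.
Qed.

Lemma calc_ex f : admissible f -> exists b, calc f b.
Proof.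
move=> af.
have /choice[b hb] : forall n, exists b, exists (I : finType) (x : I -> X) P,
    spectral_approx n.+1%:R^-1 x P /\ b = \sum_i sc (f (x i)) * P i.
  move=> n; have [|I [x [P h]]] := @spectral_approx_ex n.+1%:R^-1.
    by rewrite invr_gt0.
  by exists (\sum_i sc (f (x i)) * P i), I, x, P.
have small (d : R) : 0 < d -> exists N, forall n, (N <= n)%N -> n.+1%:R^-1 <= d.
  move=> d0; exists (Num.bound d^-1) => n hn.
  rewrite invf_ple ?posrE //; apply/ltW/(lt_le_trans (archi_boundP _)).
    by rewrite invr_ge0 ltW.
  by rewrite ler_nat leqW.
have [|l hl] := @ccomplete _ B b.
  move=> e e0; have [d d0 hd] := admissible_cauchy af e0.
  have [N hN] := small d d0; exists N => p q hp hq.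
  have [I [x [P [sP ->]]]] := hb p; have [L [y [Q [sQ ->]]]] := hb q.
  by apply: hd; [apply: spectral_approx_le sP|apply: spectral_approx_le sQ]; exact: hN.
exists l => e e0; have e2 : 0 < e / 2 by lra.
have [d d0 hd] := admissible_cauchy af e2; exists d => // I x P sP.
have [N1 hN1] := small d d0; have [N2 hN2] := hl _ e2.
have := hN2 _ (leq_maxr N1 N2); have := hN1 _ (leq_maxl N1 N2).
have [L [y [Q [sQ ->]]]] := hb (maxn N1 N2) => h1 h2.
apply: le_trans (nm_tri _ (\sum_l sc (f (y l)) * Q l) _) _.
have := hd _ _ _ _ _ _ sP (spectral_approx_le h1 sQ); lra.
Qed.

Lemma calc_uniq f b c : calc f b -> calc f c -> b = c.
Proof.
move=> cf cg; apply: nm_eq => e e0; have e2 : 0 < e / 2 by lra.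
have [d1 d10 h1] := cf _ e2; have [d2 d20 h2] := cg _ e2.
have [|I [x [P sP]]] := @spectral_approx_ex (Num.min d1 d2).
  by rewrite lt_min d10.
have := h1 _ _ _ (spectral_approx_le _ sP); rewrite ge_min lexx => /(_ isT) h1'.
have := h2 _ _ _ (spectral_approx_le _ sP); rewrite ge_min lexx orbT => /(_ isT) h2'.
apply: le_trans (nm_tri _ (\sum_i sc (f (x i)) * P i) _) _.
by rewrite [nm (b - _)]nmB; lra.
Qed.

Lemma calc_add f g b c : calc f b -> calc g c -> calc (fun p => f p + g p) (b + c).
Proof.
move=> cf cg e e0; have e2 : 0 < e / 2 by lra.
have [d1 d10 h1] := cf _ e2; have [d2 d20 h2] := cg _ e2.
exists (Num.min d1 d2) => [|I x P sP]; first by rewrite lt_min d10.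
have := h1 _ _ _ (spectral_approx_le _ sP); rewrite ge_min lexx => /(_ isT) h1'.
have := h2 _ _ _ (spectral_approx_le _ sP); rewrite ge_min lexx orbT => /(_ isT) h2'.
have -> : \sum_i sc (f (x i) + g (x i)) * P i =
    \sum_i sc (f (x i)) * P i + \sum_i sc (g (x i)) * P i.
  by rewrite -big_split; apply: eq_bigr => i _ /=; rewrite rmorphD mulrDl.
by rewrite opprD addrACA; apply: le_trans (cnmD _ _) _; lra.
Qed.

Lemma calc_scale f b (s : C) : calc f b -> calc (fun p => s * f p) (sc s * b).
Proof.
move=> cf e e0; have s0 := modulus_ge0 s.
have es : 0 < e / (modulus s + 1) by rewrite divr_gt0 //; lra.
have [d d0 h] := cf _ es; exists d => // I x P /h{h}.
have -> : \sum_i sc (s * f (x i)) * P i = sc s * \sum_i sc (f (x i)) * P i.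
  by rewrite mulr_sumr; apply: eq_bigr => i _; rewrite rmorphM mulrA.
rewrite -mulrBr cnm_sc ler_pdivlMr; last by lra.
by have := cnm_ge0 (\sum_i sc (f (x i)) * P i - b); nra.
Qed.

Lemma calc_star f b : calc f b -> calc (fun p => (f p)^*) (st b).
Proof.
move=> cf e /cf[d d0 h]; exists d => // I x P sP.
have -> : \sum_i sc (f (x i))^* * P i = st (\sum_i sc (f (x i)) * P i).
  rewrite rmorph_sum; apply: eq_bigr => i _; rewrite rmorphM cadj_sc.
  by have [/(_ i)[->]] := sP.
by rewrite -rmorphB nm_star; exact: h.
Qed.

Lemma calc_one : calc (fun=> 1) 1.
Proof.
move=> e e0; exists 1 => // I x P [_ sP _].
rewrite (eq_bigr P) => [|i _]; last by rewrite rmorph1 mul1r.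
by rewrite sP subrr nm0 ltW.
Qed.

(* Cauchy-Schwarz: the squared mean of [k_j - a_j] is at most its second moment. *)
Lemma calc_coord j : calc (k^~ j) (a j).
Proof.
move=> e e0; exists (e ^+ 2); first exact: exprn_gt0.
move=> I x P [pP sP hP]; pose u i := sc (k (x i) j) - a j.
have -> : \sum_i sc (k (x i) j) * P i - a j = \sum_i u i * P i.
  rewrite -[a j]mulr1 -sP mulr_sumr -sumrB; apply: eq_bigr => i _.
  by rewrite /u mulrBl.
set T := \sum_i _; rewrite -(@ler_pXn2r _ 2) ?nnegrE ?cnm_ge0 ?(ltW e0) // -cnm_st.
apply: le_trans hP; apply: nm_mono; first exact: pos_st.
(* The difference is the variance of [u] about its mean [T] plus the second moments of the other
   coordinates. *)
have -> : \sum_i dist2 a (k (x i)) * P i - st T * T =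
    \sum_i (st (u i - T) * (u i - T) * P i) +
    \sum_i (dist2 a (k (x i)) - st (u i) * u i) * P i.
  have sT : st T = \sum_i st (u i) * P i.
    rewrite rmorph_sum; apply: eq_bigr => i _; rewrite rmorphM.
    by have [->] := pP i.
  rewrite [X in _ = X + _](eq_bigr (fun i => st (u i) * u i * P i - T * (st (u i) * P i) -
    st T * (u i * P i) + st T * T * P i)) => [|i _]; last by rewrite rmorphB; ring.
  rewrite !big_split /= !sumrN -!mulr_sumr -sT sP -/T.
  rewrite [X in _ = _ + X](eq_bigr (fun i => dist2 a (k (x i)) * P i - st (u i) * u i * P i))
    => [|i _]; last by ring.
  by rewrite sumrB; ring.
apply: posD; apply: pos_sum => i; apply: posM => //; first exact: pos_st.
rewrite /dist2 (bigD1 j) //= -/(u i) addrAC subrr add0r.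
apply: big_ind => [||l _]; [exact: pos0|exact: posD|exact: pos_st].
Qed.

(** Over two independent copies of one approximation, the sum for [f g] minus [Sf * Sg] is the
    double sum of [f x (g x - g y)]: the bound on [f] and the admissibility of [g] make it small. *)
Lemma calc_mul f g b c : admissible f -> admissible g -> calc f b -> calc g c ->
  calc (fun p => f p * g p) (b * c).
Proof.
move=> af ag cf cg e e0.
have [M M0 hM] := admissible_bound af.
have D0 : 0 < 8 * (M + 1) by lra.
have eM0 : 0 < e / (8 * (M + 1)) by rewrite divr_gt0.
have [K K0 hK] := ag _ eM0; have K1 : 0 < 32 * (M + 1) * (K + 1) by nra.
have b0 := cnm_ge0 b; have c0 := cnm_ge0 c.
have eb : 0 < e / (4 * (nm b + 1)) by rewrite divr_gt0 //; lra.
pose ec := Num.min 1 (e / (4 * (nm b + 1))).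
have ec0 : 0 < ec by rewrite lt_min ltr01.
have ef0 : 0 < e / (4 * (nm c + 1)) by rewrite divr_gt0 //; lra.
have [d1 d10 h1] := cf _ ef0; have [d2 d20 h2] := cg _ ec0.
(* The double sum is at most [2 (e / 8 + 4 M K d3) <= e / 2]; the other half of [e] pays for
   replacing [Sf * Sg] by [b * c]. *)
pose d3 := e / (32 * (M + 1) * (K + 1)); have d30 : 0 < d3 by rewrite divr_gt0.
exists (Num.min d3 (Num.min d1 d2)) => [|I x P sP]; first by rewrite !lt_min d10 d20 d30.
have sP3 : spectral_approx d3 x P.
  by apply: spectral_approx_le sP; rewrite !ge_min lexx.
have := h1 _ _ _ (spectral_approx_le _ sP); rewrite !ge_min lexx !orbT => /(_ isT).
have := h2 _ _ _ (spectral_approx_le _ sP); rewrite !ge_min lexx !orbT => /(_ isT).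
set Sf := \sum_i sc (f (x i)) * P i; set Sg := \sum_i sc (g (x i)) * P i => hg hf.
have [_ P1 _] := sP.
have e1 : \sum_i sc (f (x i) * g (x i)) * P i - Sf * Sg =
    \sum_(p : I * I) sc (f (x p.1) * (g (x p.1) - g (x p.2))) * (P p.1 * P p.2).
  rewrite -(sum_prod1 (fun i => sc (f (x i) * g (x i)) * P i) P1) -sum_prod -sumrB.
  by apply: eq_bigr => p _; rewrite !rmorphM rmorphB; ring.
have cK p q : modulus (f p * (g p - g q)) <=
    M * (e / (8 * (M + 1))) + M * K * sqdist (k p) (k q).
  by rewrite modulusM -mulrA -mulrDr ler_pM ?modulus_ge0.
have a1 : 0 <= M * (e / (8 * (M + 1))) by rewrite mulr_ge0 // ltW.
have := spectral_approx_comb a1 (mulr_ge0 M0 K0) cK sP3 sP3; rewrite -e1 => n1.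
have n2 : nm (Sf * Sg - b * c) <= e / 2.
  have -> : Sf * Sg - b * c = (Sf - b) * (c + (Sg - c)) + b * (Sg - c) by ring.
  have hc : nm (c + (Sg - c)) <= nm c + 1.
    apply: le_trans (cnmD _ _) _; rewrite lerD2l; apply: le_trans hg _.
    by rewrite ge_min lexx.
  have hg' : nm (Sg - c) <= e / (4 * (nm b + 1)).
    by apply: le_trans hg _; rewrite ge_min lexx orbT.
  apply: le_trans (cnmD _ _) _.
  have t1 : nm ((Sf - b) * (c + (Sg - c))) <= e / (4 * (nm c + 1)) * (nm c + 1).
    by apply: le_trans (cnmM _ _) _; apply: ler_pM; rewrite ?cnm_ge0.
  have t2 : nm (b * (Sg - c)) <= (nm b + 1) * (e / (4 * (nm b + 1))).
    by apply: le_trans (cnmM _ _) _; apply: ler_pM; rewrite ?cnm_ge0 //; lra.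
  have : e / (4 * (nm c + 1)) * (nm c + 1) = e / 4 by field; lra.
  have : (nm b + 1) * (e / (4 * (nm b + 1))) = e / 4 by field; lra.
  by lra.
apply: le_trans (nm_tri _ (Sf * Sg) _) _.
have : M * (e / (8 * (M + 1))) <= e / 8.
  have -> : M * (e / (8 * (M + 1))) = M / (M + 1) * (e / 8) by field; lra.
  by apply: ler_piMl; [lra|rewrite ler_pdivrMr; lra].
have : M * K * d3 <= e / 32.
  have -> : M * K * d3 = M / (M + 1) * (K / (K + 1)) * (e / 32).
    by rewrite /d3; field; rewrite !gt_eqF; lra.
  apply: ler_piMl; first lra.
  have M1 : 0 < M + 1 by rewrite ltr_wpDl.
  have K2 : 0 < K + 1 by rewrite ltr_wpDl.
  by apply: mulr_ile1; rewrite ?divr_ge0 ?(ltW M1) ?(ltW K2) // ler_pdivrMr // mul1r lerDl.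
rewrite (_ : M * K * (2 * (d3 + d3)) = 4 * (M * K * d3)) in n1; last by ring.
by lra.
Qed.

(** For every real [t], [t <= e + t^2 / e]. *)
Lemma admissible_coord j : admissible (k^~ j).
Proof.
move=> e e0; exists (e^-1); first by rewrite invr_ge0 ltW.
move=> p q; have h : modulus (k p j - k q j) ^+ 2 <= sqdist (k p) (k q).
  by rewrite /sqdist (bigD1 j) //= lerDl sumr_ge0 // => l _; exact: sqr_ge0.
apply: (@le_trans _ _ (e + e^-1 * modulus (k p j - k q j) ^+ 2)); last first.
  by rewrite lerD2l ler_pM2l ?invr_gt0.
set t := modulus _; have -> : e + e^-1 * t ^+ 2 = e^-1 * (e ^+ 2 + t ^+ 2).
  by field; lra.
by rewrite ler_pdivlMl //; have := sqr_ge0 (e - t); have := sqr_ge0 t; nra.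
Qed.

(* A small-variance approximation for [a] is carried by [beta], together with
   the inverse translation of the points, to another one. *)
Lemma calc_equivariant (beta : {rmorphism B -> B}) (chi chi' : C) (tau tau' : X -> X)
    (f : X -> C) (b : B) :
  (forall x, nm (beta x) = nm x) -> (forall x, st (beta x) = beta (st x)) ->
  (forall c, beta (sc c) = sc c) -> (forall j, beta (a j) = sc chi * a j) ->
  chi * chi' = 1 -> chi^* * chi = 1 ->
  (forall p j, k (tau p) j = chi * k p j) -> (forall p j, k (tau' p) j = chi' * k p j) ->
  admissible f -> calc f b -> calc (f \o tau) (beta b).
Proof.
move=> nb sb cb ab c1 c2 kt kt' af cf.
have mchi : modulus chi = 1.
  apply/eqP; rewrite -(@eqrXn2 _ 2) ?modulus_ge0 // expr1n; apply/eqP/(@complexI R).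
  by rewrite rmorphXn /= -modulusE normCKC c2.
have af' : admissible (f \o tau).
  move=> e /af[K K0 hK]; exists K => // p q; apply: le_trans (hK _ _) _.
  rewrite lerD2l ler_wpM2l // le_eqVlt; apply/orP; left; apply/eqP.
  by apply: eq_bigr => j _; rewrite !kt -mulrBr modulusM mchi mul1r.
(* The points [tau (tau' p)] and [p] are only known to have equal coordinates, and an admissible [f]
   does not distinguish such points. *)
have ff p : f (tau (tau' p)) = f p.
  have kk : k (tau (tau' p)) = k p.
    by apply/funext => j; rewrite kt kt' mulrA c1 mul1r.
  apply/eqP; rewrite -subr_eq0 -normr_eq0 modulusE; apply/eqP.
  suff -> : modulus (f (tau (tau' p)) - f p) = 0 by [].
  apply/eqP; rewrite eq_le modulus_ge0 andbT; apply/ler_addgt0Pr => e e0.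
  have [K K0 hK] := af e e0; rewrite add0r; apply: le_trans (hK _ _) _.
  rewrite kk /sqdist big1 ?mulr0 ?addr0 // => j _.
  by rewrite subrr /modulus normr0 expr0n.
(* The value [b'] of [f \o tau] exists because [tau] preserves coordinate distances. It is
   identified with [beta b] on one approximation and its transport. *)
have [b' cb'] := calc_ex af'; rewrite (_ : beta b = b') //.
apply: nm_eq => e e0; have e2 : 0 < e / 2 by lra.
have [d1 d10 h1] := cf _ e2; have [d2 d20 h2] := cb' _ e2.
have [|I [x [P sP]]] := @spectral_approx_ex (Num.min d1 d2).
  by rewrite lt_min d10.
have := h1 _ _ _ (spectral_approx_le _ sP); rewrite ge_min lexx => /(_ isT) h1'.
have sP' : spectral_approx d2 (tau' \o x) (beta \o P).
  have [pP P1 dP] := sP; split.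
  - move=> i; have [saP [t ht]] := pP i; split; first by rewrite /sa /= sb saP.
    by exists t; rewrite /= -(cb ((t%:C)%C)) -rmorphB nb.
  - by rewrite -(rmorph_sum beta) P1 rmorph1.
  - rewrite (_ : \sum_i _ = beta (\sum_i dist2 a (k (x i)) * P i)).
      by rewrite nb; apply: le_trans dP _; rewrite ge_min lexx orbT.
    rewrite rmorph_sum; apply: eq_bigr => i _; rewrite rmorphM; congr (_ * _).
    rewrite /dist2 rmorph_sum; apply: eq_bigr => j _ /=.
    rewrite [RHS]rmorphM -sb [beta (_ - _)]rmorphB cb ab kt'.
    have -> : sc (k (x i) j) - sc chi * a j = sc chi * (sc (chi' * k (x i) j) - a j).
      by rewrite mulrBr -rmorphM mulrA c1 mul1r.
    by rewrite [st (sc chi * _)]rmorphM mulrACA cadj_sc -rmorphM c2 rmorph1 mul1r.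
have := h2 _ _ _ sP' => h2'.
apply: le_trans (nm_tri _ (\sum_i sc ((f \o tau) ((tau' \o x) i)) * (beta \o P) i) _) _.
rewrite (_ : \sum_i _ = beta (\sum_i sc (f (x i)) * P i)) in h2' *; last first.
  by rewrite rmorph_sum; apply: eq_bigr => i _; rewrite /= ff rmorphM cb.
by rewrite -rmorphB nb [nm (b - _)]nmB; lra.
Qed.
End Systems.

Lemma sqr_modulusM t (c : C) : modulus ((t%:C)%C * c) ^+ 2 = t ^+ 2 * modulus c ^+ 2.
Proof. by rewrite modulusM exprMn modulus_real real_normK ?num_real. Qed.

Section Retractions.
Variables (m : nat) (a : 'I_m.+1 -> B).
Implicit Types (z w : 'I_m.+1 -> C).
Let N := \sum_j st (a j) * a j.
Let Z w : B := \sum_j st (sc (w j)) * sc (w j).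
Let W w : B := \sum_j (st (sc (w j)) * a j + st (a j) * sc (w j)).

Let dist2_ray t w : dist2 a (fun j => (t%:C)%C * w j) = rs (t ^+ 2) * Z w - rs t * W w + N.
Proof.
rewrite /dist2 /Z /W /N !mulr_sumr -sumrB -big_split; apply: eq_bigr => j _ /=.
by rewrite rmorphB rmorphM [st (rs t * _)]rmorphM st_rs; ring.
Qed.

Let dist2_1 w : dist2 a w = Z w - W w + N.
Proof.
have := dist2_ray 1 w; rewrite expr1n !rmorph1 !mul1r => <-.
by congr (dist2 a _); apply/funext => j; rewrite mul1r.
Qed.

Definition sqnorm z : R := \sum_j modulus (z j) ^+ 2.

Let Z_unit w : sqnorm w = 1 -> Z w = 1.
Proof.
move=> h; rewrite -(rmorph1 sc) -(rmorph1 (@real_complex R)) -h /sqnorm !rmorph_sum.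
by apply: eq_bigr => j _; rewrite rs_modulus.
Qed.

Lemma polar z : exists t w, [/\ 0 <= t, sqnorm w = 1 & z = fun j => (t%:C)%C * w j].
Proof.
have n0 : 0 <= sqnorm z by apply: sumr_ge0 => j _; exact: sqr_ge0.
have [e|ne] := eqVneq (sqnorm z) 0.
  exists 0, (fun j => if j == ord0 then 1 else 0); split => //.
    rewrite /sqnorm (bigD1 ord0) //= big1 ?addr0 => [|j /negbTE ->].
      by rewrite /modulus normr1 expr1n.
    by rewrite /modulus normr0 expr0n.
  apply/funext => j; rewrite mul0r; apply/eqP; rewrite -normr_eq0 modulusE.
  have /eqP := e; rewrite psumr_eq0 => [|i _]; last exact: sqr_ge0.
  by move=> /allP/(_ j (mem_index_enum _)); rewrite sqrf_eq0 => /eqP ->.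
have n1 : 0 < sqnorm z by rewrite lt_neqAle eq_sym ne.
have s0 : 0 < Num.sqrt (sqnorm z) by rewrite sqrtr_gt0.
exists (Num.sqrt (sqnorm z)), (fun j => (((Num.sqrt (sqnorm z))^-1)%:C)%C * z j); split.
- exact: ltW.
- rewrite /sqnorm; under eq_bigr do rewrite sqr_modulusM exprVn.
  by rewrite -mulr_sumr sqr_sqrtr ?ltW // mulVf.
- by apply/funext => j; rewrite mulrA -rmorphM mulfV ?mul1r // lt0r_neq0.
Qed.

Variables (X : Type) (k : X -> 'I_m.+1 -> C).

(** Radial projection. For unit [w] and [N = 1] all terms are affine in [W w], hence combinations of
    [|w - a|^2 = 2 - W w] and [|-w - a|^2 = 2 + W w]; the coefficients [(1 - t)^2] and [t^2 + 2 t]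
    are nonnegative. *)
Lemma retract_sphere : N = 1 -> (forall w, sqnorm w = 1 -> exists p, k p = w) ->
  forall z, exists p, pos (4 * dist2 a z - dist2 a (k p)).
Proof.
move=> N1 ks z; have [t [w [t0 w1 ->]]] := polar z; have [x kx] := ks w w1; exists x; rewrite kx.
have -> : 4 * dist2 a (fun j => (t%:C)%C * w j) - dist2 a w =
    rs ((1 - t) ^+ 2) * dist2 a (fun j => ((-1)%:C)%C * w j) +
    rs (t ^+ 2 + 2 * t) * dist2 a w.
  by rewrite !dist2_ray dist2_1 (Z_unit w1) N1; ring.
apply: posD; apply: posZ; [exact: sqr_ge0|exact: pos_dist2| |exact: pos_dist2].
by rewrite addr_ge0 ?sqr_ge0 // mulr_ge0.
Qed.

(** Points of the ball stay in place. For [t > 1] the radial projection does not increase the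
    distance: [|t w - a|^2 - |w - a|^2 = (t - 1) ((t - 1) + (1 - N) + |w - a|^2)]. *)
Lemma retract_ball : pos (1 - N) -> (forall w, sqnorm w <= 1 -> exists p, k p = w) ->
  forall z, exists p, pos (4 * dist2 a z - dist2 a (k p)).
Proof.
move=> N1 ks z; have [t [w [t0 w1 ->]]] := polar z.
have p3 u : pos (3 * dist2 a u).
  apply: posM; last exact: pos_dist2.
  by rewrite -(rmorph_nat sc) -(rmorph_nat (@real_complex R)); exact: pos_rs.
have [t1|t1] := lerP t 1.
  have [|x kx] := ks (fun j => (t%:C)%C * w j).
    rewrite /sqnorm; under eq_bigr do rewrite sqr_modulusM.
    by rewrite -mulr_sumr [X in _ * X]w1 mulr1 expr_le1.
  by exists x; rewrite kx (_ : _ - _ = 3 * dist2 a (fun j => (t%:C)%C * w j)) //; ring.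
have [|x kx] := ks w; first by rewrite w1.
exists x; rewrite kx; have -> : 4 * dist2 a (fun j => (t%:C)%C * w j) - dist2 a w =
    3 * dist2 a (fun j => (t%:C)%C * w j) +
    rs (t - 1) * (rs (t - 1) + (1 - N) + dist2 a w).
  by rewrite !dist2_ray dist2_1 (Z_unit w1); ring.
apply: posD => //; apply: posZ; first by lra.
apply: posD; last exact: pos_dist2.
by apply: posD => //; apply: pos_rs; lra.
Qed.
End Retractions.

End JointCalculus.

(** * Bicommutants as commutative C*-algebras *)

Section Bicommutant.
Variables (R : realType) (A : cstarAlgType R).
Local Notation C := (Cx R).

Definition anorm (a : A) : R := complex.Re `|a|.

Lemma anormE (a : A) : `|a| = ((anorm a)%:C)%C.
Proof. by rewrite /anorm RRe_real // ger0_real. Qed.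

Lemma anorm_ge0 (a : A) : 0 <= anorm a.
Proof. by rewrite -(ler0c (anorm a)) -anormE. Qed.

Lemma anormD (a b : A) : anorm (a + b) <= anorm a + anorm b.
Proof. by rewrite -lecR rmorphD /= -!anormE ler_normD. Qed.

Lemma anormN (a : A) : anorm (- a) = anorm a.
Proof. by rewrite /anorm normrN. Qed.

Lemma anormM (a b : A) : anorm (a * b)%g <= anorm a * anorm b.
Proof. by rewrite -lecR rmorphM /= -!anormE cnormM. Qed.

Lemma anormZ (c : C) (a : A) : anorm (c *: a) = modulus c * anorm a.
Proof. by apply: (@complexI R); rewrite rmorphM /= -!anormE -modulusE normrZ. Qed.

Lemma anorm_star (a : A) : anorm (star a * a)%g = anorm a ^+ 2.
Proof. by apply: (@complexI R); rewrite rmorphXn /= -!anormE cstar_identity. Qed.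

Lemma anorm_eq0 (a : A) : anorm a = 0 -> a = 0.
Proof. by move=> h; apply/normr0_eq0; rewrite anormE h. Qed.

Lemma anorm_complete (u : nat -> A) :
  (forall e : R, 0 < e -> exists N, forall m n, (N <= m)%N -> (N <= n)%N ->
     anorm (u m - u n) <= e) ->
  exists l, forall e : R, 0 < e -> exists N, forall n, (N <= n)%N -> anorm (u n - l) <= e.
Proof.
move=> hu.
have real_eps (e : C) : 0 < e -> e = ((complex.Re e)%:C)%C /\ 0 < complex.Re e.
  move=> e0; have e' : e = ((complex.Re e)%:C)%C.
    by rewrite RRe_real // ger0_real // ltW.
  by split => //; rewrite -ltcR -e'.
have : cvg (u @ \oo).
  apply/cauchy_cvgP/cauchy_exP => e /real_eps[e1 e2].
  have [N hN] := hu (complex.Re e / 2) (divr_gt0 e2 (ltr0Sn _ _)).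
  exists (u N); exists N => // n /= Nn; rewrite -ball_normE /= anormE e1 ltcR.
  by apply: le_lt_trans (hN _ _ _ _) _ => //; lra.
move=> /cvg_ex[l hl]; exists l => e e0.
have e0' : (0 : C) < (e%:C)%C by rewrite -(rmorph0 (@real_complex R)) ltcR.
move/cvgrPdist_le : hl => /(_ _ e0')[N _ hN]; exists N => n Nn.
by have := hN n Nn; rewrite /= anormE lecR -anormN opprB.
Qed.

Lemma smul0 (a : A) : (a * 0%R)%g = 0.
Proof. by apply: (@addrI _ (a * 0%R)%g); rewrite -cmulDr !addr0. Qed.
Lemma smul0l (a : A) : (0%R * a)%g = 0.
Proof. by apply: (@addrI _ (0%R * a)%g); rewrite -cmulDl !addr0. Qed.
Lemma smulN (a b : A) : (a * (- b)%R)%g = - (a * b)%g.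
Proof. by apply: (@addrI _ (a * b)%g); rewrite -cmulDr !subrr smul0. Qed.
Lemma smulNl (a b : A) : ((- a)%R * b)%g = - (a * b)%g.
Proof. by apply: (@addrI _ (a * b)%g); rewrite -cmulDl !subrr smul0l. Qed.
Lemma smulBr (a b c : A) : (a * (b - c)%R)%g = (a * b)%g - (a * c)%g.
Proof. by rewrite cmulDr smulN. Qed.
Lemma smulBl (a b c : A) : ((b - c)%R * a)%g = (b * a)%g - (c * a)%g.
Proof. by rewrite cmulDl smulNl. Qed.

Lemma star0 : star (0 : A) = 0.
Proof. by rewrite -(scale0r (0 : A)) starZ rmorph0 !scale0r. Qed.
Lemma starN (a : A) : star (- a) = - star a.
Proof. by rewrite -scaleN1r starZ rmorphN rmorph1 scaleN1r. Qed.
Lemma star1 : star (1%g : A) = 1%g.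
Proof. by rewrite -[LHS]mul1g -{1}(starK (1%g : A)) -starM mul1g starK. Qed.

Definition commutant (S : set A) : set A := [set x | forall y, S y -> (x * y = y * x)%g].

Record commset := Commset {
  cset :> set A;
  cset_comm : forall x y, cset x -> cset y -> (x * y = y * x)%g;
  cset_star : forall x, cset x -> cset (star x) }.

Variable S : commset.

(** Chosen instead of the generated closed subalgebra because commutation conditions pass to limits
    and to all the operations, and are transported by automorphisms. *)
Definition bicommutant : set A := commutant (commutant S).

Lemma sub_bicommutant x : cset S x -> bicommutant x.
Proof. by move=> Sx y /(_ x Sx). Qed.

(** Since [S] commutes with itself, [S] lies in its commutant; hence the bicommutant does too, and
    its elements commute with each other. *)
Lemma bicommutant_comm x y : bicommutant x -> bicommutant y -> (x * y = y * x)%g.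
Proof.
by move=> bx by_; apply: bx => z Sz; apply: by_ => w Sw; exact: (cset_comm Sz Sw).
Qed.

Lemma commutant_star y : commutant S y -> commutant S (star y).
Proof. by move=> h x Sx; rewrite -[x](starK) -!starM h //; exact: cset_star. Qed.

Lemma bicommutant_closed (u : nat -> A) l : (forall n, bicommutant (u n)) ->
  (forall e : R, 0 < e -> exists N, forall n, (N <= n)%N -> anorm (u n - l) <= e) ->
  bicommutant l.
Proof.
move=> bu hl y Sy; apply/eqP; rewrite -subr_eq0; apply/eqP/anorm_eq0.
apply/eqP; rewrite eq_le anorm_ge0 andbT; apply/ler_addgt0Pr => e e0; rewrite add0r.
have n0 := anorm_ge0 y.
have e1 : 0 < e / (2 * (anorm y + 1)) by rewrite divr_gt0 //; lra.
have [N hN] := hl _ e1.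
have -> : (l * y)%g - (y * l)%g = (y * (u N - l)%R)%g - ((u N - l)%R * y)%g.
  by rewrite smulBl smulBr (bu N y Sy) opprB [RHS]addrC subrKA.
apply: le_trans (anormD _ _) _; rewrite anormN.
have h1 := anormM y (u N - l); have h2 := anormM (u N - l) y.
have h3 := hN N (leqnn N).
have h4 : anorm y * anorm (u N - l) <= (anorm y + 1) * (e / (2 * (anorm y + 1))).
  by apply: ler_pM; rewrite ?anorm_ge0 // lerDl.
have h5 : (anorm y + 1) * (e / (2 * (anorm y + 1))) = e / 2 by field; lra.
rewrite [anorm (u N - l) * _]mulrC in h2; lra.
Qed.

Definition bicomm : Type := {x : A | `[< bicommutant x >]}.
HB.instance Definition _ := Choice.on bicomm.
HB.instance Definition _ := SubType.on bicomm.

Definition mk_bicomm x (h : bicommutant x) : bicomm := exist _ x (asboolT h).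

Lemma bicommP (x : bicomm) : bicommutant (val x).
Proof. by case: x => x /= /asboolP. Qed.

Lemma bicommutant0 : bicommutant 0.
Proof. by move=> y _; rewrite smul0 smul0l. Qed.
Lemma bicommutantN x : bicommutant x -> bicommutant (- x).
Proof. by move=> h y /h e; rewrite smulN smulNl e. Qed.
Lemma bicommutantD x y : bicommutant x -> bicommutant y -> bicommutant (x + y).
Proof. by move=> hx hy z hz; rewrite cmulDl cmulDr hx ?hy. Qed.
Lemma bicommutant1 : bicommutant 1%g.
Proof. by move=> y _; rewrite mul1g mulg1. Qed.
Lemma bicommutantM x y : bicommutant x -> bicommutant y -> bicommutant (x * y)%g.
Proof. by move=> hx hy z hz; rewrite -(mulgA x) (hy _ hz) mulgA (hx _ hz) mulgA. Qed.
Lemma bicommutantZ (c : C) x : bicommutant x -> bicommutant (c *: x).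
Proof. by move=> hx z hz; rewrite -cscaleAl -cscaleAr hx. Qed.
Lemma bicommutant_star x : bicommutant x -> bicommutant (star x).
Proof.
by move=> hx y /commutant_star hy; rewrite -[y]starK -!starM hx.
Qed.

Definition bicomm_zero := mk_bicomm bicommutant0.
Definition bicomm_opp (x : bicomm) := mk_bicomm (bicommutantN (bicommP x)).
Definition bicomm_add (x y : bicomm) := mk_bicomm (bicommutantD (bicommP x) (bicommP y)).
Definition bicomm_one := mk_bicomm bicommutant1.
Definition bicomm_mul (x y : bicomm) := mk_bicomm (bicommutantM (bicommP x) (bicommP y)).

Lemma bicomm_addA : associative bicomm_add. Proof. by move=> x y z; apply: val_inj; rewrite /= addrA. Qed.
Lemma bicomm_addC : commutative bicomm_add. Proof. by move=> x y; apply: val_inj; rewrite /= addrC. Qed.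
Lemma bicomm_add0 : left_id bicomm_zero bicomm_add. Proof. by move=> x; apply: val_inj; rewrite /= add0r. Qed.
Lemma bicomm_addN : left_inverse bicomm_zero bicomm_opp bicomm_add.
Proof. by move=> x; apply: val_inj; rewrite /= addNr. Qed.
HB.instance Definition _ := GRing.isZmodule.Build bicomm bicomm_addA bicomm_addC bicomm_add0 bicomm_addN.

Lemma bicomm_mulA : associative bicomm_mul. Proof. by move=> x y z; apply: val_inj; rewrite /= mulgA. Qed.
Lemma bicomm_mulC : commutative bicomm_mul.
Proof. by move=> x y; apply: val_inj; apply: bicommutant_comm; exact: bicommP. Qed.
Lemma bicomm_mul1 : left_id bicomm_one bicomm_mul. Proof. by move=> x; apply: val_inj; rewrite /= mul1g. Qed.
Lemma bicomm_mulDl : left_distributive bicomm_mul bicomm_add.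
Proof. by move=> x y z; apply: val_inj; rewrite /= cmulDl. Qed.
HB.instance Definition _ := GRing.Zmodule_isComPzRing.Build bicomm bicomm_mulA bicomm_mulC bicomm_mul1 bicomm_mulDl.

Definition bicomm_scal (c : C) : bicomm := mk_bicomm (bicommutantZ c bicommutant1).
Lemma bicomm_scalB : zmod_morphism bicomm_scal.
Proof. by move=> c d; apply: val_inj; rewrite /= scalerBl. Qed.
Lemma bicomm_scalM : monoid_morphism bicomm_scal.
Proof.
split=> [|c d]; apply: val_inj; rewrite /= ?scale1r //.
by rewrite -cscaleAl mul1g scalerA.
Qed.
HB.instance Definition _ := GRing.isZmodMorphism.Build C bicomm bicomm_scal bicomm_scalB.
HB.instance Definition _ := GRing.isMonoidMorphism.Build C bicomm bicomm_scal bicomm_scalM.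

Definition bicomm_star (x : bicomm) : bicomm := mk_bicomm (bicommutant_star (bicommP x)).
Lemma bicomm_starB : zmod_morphism bicomm_star.
Proof. by move=> x y; apply: val_inj; rewrite /= starD starN. Qed.
Lemma bicomm_starM : monoid_morphism bicomm_star.
Proof.
split=> [|x y]; apply: val_inj; rewrite /= ?star1 // starM.
by apply: bicommutant_comm; apply: bicommutant_star; exact: bicommP.
Qed.
HB.instance Definition _ := GRing.isZmodMorphism.Build bicomm bicomm bicomm_star bicomm_starB.
HB.instance Definition _ := GRing.isMonoidMorphism.Build bicomm bicomm bicomm_star bicomm_starM.

Definition bicomm_norm (x : bicomm) : R := anorm (val x).

Lemma bicomm_starK : involutive bicomm_star.
Proof. by move=> x; apply: val_inj; rewrite /= starK. Qed.
Lemma bicomm_star_scal c : bicomm_star (bicomm_scal c) = bicomm_scal c^*.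
Proof. by apply: val_inj; rewrite /= starZ star1. Qed.
Lemma bicomm_norm_eq0 x : bicomm_norm x = 0 -> x = 0.
Proof. by move=> /anorm_eq0 h; apply: val_inj. Qed.
Lemma bicomm_norm_scal c x : bicomm_norm (bicomm_scal c * x) = modulus c * bicomm_norm x.
Proof. by rewrite /bicomm_norm -anormZ /= -cscaleAl mul1g. Qed.
Lemma bicomm_complete (u : nat -> bicomm) :
    (forall e : R, 0 < e -> exists N, forall m n, (N <= m)%N -> (N <= n)%N ->
       bicomm_norm (u m - u n) <= e) ->
    exists l, forall e : R, 0 < e -> exists N, forall n, (N <= n)%N -> bicomm_norm (u n - l) <= e.
Proof.
move=> /(@anorm_complete (fun n => val (u n)))[l hl].
by exists (mk_bicomm (bicommutant_closed (fun n => bicommP (u n)) hl)).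
Qed.

Definition bicommutant_algebra : ccstar R :=
  @CCstar R bicomm bicomm_scal bicomm_star bicomm_norm bicomm_starK bicomm_star_scal (fun x => anorm_ge0 _) bicomm_norm_eq0
    (fun x y => anormD _ _) (fun x y => anormM _ _) bicomm_norm_scal (fun x => anorm_star _)
    bicomm_complete.

End Bicommutant.

(** Expanded form of [(x + y)^2 - (x - y)^2 = 2 (y x + x y)] for noncommuting [x] and [y], where
    [p], [q], [r], [s] stand for [x x], [x y], [y x], [y y]. *)
Lemma polarization_sum (V : zmodType) (p q r s : V) :
  p + q + (r + s) - (p - q - (r - s)) = (r + q) *+ 2.
Proof.
rewrite [r + s]addrC addrACA [q + r]addrC.
have -> : p - q - (r - s) = (p + s) - (r + q).
  by rewrite opprB addrACA opprD [- q - r]addrC.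
by rewrite opprB [p + s + _]addrC addrACA subrr addr0 mulr2n.
Qed.

(** * Positive elements and commutators in C*-algebras *)

Section PositiveElements.
Variables (R : realType) (A : cstarAlgType R).
Local Notation C := (Cx R).
Local Notation ra t := ((t%:C)%C *: (1%g : A)).
Implicit Types (x y h s : A) (t : R).

Section Family.
Variables (I : Type) (a : I -> A).
Hypothesis comm : forall i j, (a i * a j = a j * a i)%g.
Hypothesis comm_star : forall i j, (a i * star (a j) = star (a j) * a i)%g.

Definition family_set : set A := [set x | exists i, x = a i \/ x = star (a i)].

Lemma family_set_comm x y : family_set x -> family_set y -> (x * y = y * x)%g.
Proof.
move=> [i [->|->]] [j [->|->]]; rewrite ?comm_star //.
by rewrite -!starM comm.
Qed.

Lemma family_set_star x : family_set x -> family_set (star x).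
Proof. by move=> [i [->|->]]; exists i; [right|left; rewrite starK]. Qed.

Definition family_commset := Commset family_set_comm family_set_star.

Lemma family_bicommutant i : bicommutant family_commset (a i).
Proof. by apply: sub_bicommutant; exists i; left. Qed.

Definition family_elt i : bicommutant_algebra family_commset := mk_bicomm (family_bicommutant i).
End Family.

(* This form of positivity is additive without any commutation. *)
Definition positive h : Prop := star h = h /\ exists t, anorm (ra t - h) <= t.

Lemma pos_val (S : commset A) (x : bicommutant_algebra S) :
  pos x <-> positive (val (x : bicomm S)).
Proof.
split=> -[sx hx]; split => //.
  by have := congr1 (fun z : bicomm S => val z) sx.
exact: val_inj.
Qed.

(* Transfers facts on a single normal element from the commutative case. *)
Lemma normal_commset (x : A) : normal x ->
  exists (S : commset A) (z : bicommutant_algebra S), val (z : bicomm S) = x.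
Proof.
move=> nx; have c1 (i j : unit) : (x * x = x * x)%g by [].
have c2 (i j : unit) : (x * star x = star x * x)%g by rewrite nx.
by exists (family_commset c1 c2), (family_elt c1 c2 tt).
Qed.

Lemma sa_normal x : star x = x -> normal x.
Proof. by rewrite /normal => ->. Qed.

Lemma positiveD h y : positive h -> positive y -> positive (h + y).
Proof.
move=> [sh [t ht]] [sy [u hu]]; split; first by rewrite starD sh sy.
exists (t + u); rewrite rmorphD scalerDl opprD addrACA.
by apply: le_trans (anormD _ _) _; exact: lerD.
Qed.

Lemma positive0 : positive 0.
Proof. by split; [exact: star0|exists 0; rewrite rmorph0 scale0r subrr /anorm normr0]. Qed.

Lemma positive_sum (I : finType) (P : pred I) (F : I -> A) :
  (forall i, positive (F i)) -> positive (\sum_(i | P i) F i).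
Proof. by move=> h; apply: big_ind => //; [exact: positive0|exact: positiveD]. Qed.

Lemma positive_sqr s : star s = s -> positive (s * s)%g.
Proof.
move=> ss; have [S [z zE]] := normal_commset (sa_normal ss).
have sz : sa z by apply: val_inj; rewrite /= zE.
by have /pos_val := pos_sq sz; rewrite /= zE.
Qed.

Lemma positive_normal x : normal x -> positive (x * star x)%g.
Proof.
move=> nx; have [S [z zE]] := normal_commset nx.
by have /pos_val := pos_st z; rewrite /= zE nx.
Qed.

Lemma positive_sqrt h : positive h -> exists2 s, star s = s & h = (s * s)%g.
Proof.
move=> ph; have [S [z zE]] := normal_commset (sa_normal ph.1).
have /pos_sqrt[s ss e] : pos z by apply/pos_val; rewrite zE.
exists (val (s : bicomm S)); first by have := congr1 (fun z : bicomm S => val z) ss.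
by rewrite -zE e.
Qed.

Lemma anorm_le_positive M h : 0 <= M -> positive h -> positive (ra M - h) -> anorm h <= M.
Proof.
move=> M0 ph pMh; have [S [z zE]] := normal_commset (sa_normal ph.1).
have pz : pos z by apply/pos_val; rewrite zE.
rewrite -zE; apply: (@nm_le_pos _ (bicommutant_algebra S) _ z) => //.
by apply/pos_val; rewrite /= zE.
Qed.

Lemma positive_near M x : star x = x -> anorm x <= M ->
  positive (ra M - x) /\ positive (ra M + x).
Proof.
move=> sx nx; have [S [z zE]] := normal_commset (sa_normal sx).
have sz : sa z by apply: val_inj; rewrite /= zE.
have [|p1 p2] := @pos_near _ (bicommutant_algebra S) z M sz; first by rewrite /= /bicomm_norm zE.
by split; [have /pos_val := p1|have /pos_val := p2]; rewrite /= zE.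
Qed.

Lemma anorm_le_abs M x : 0 <= M -> star x = x -> positive (ra M - x) ->
  positive (ra M + x) -> anorm x <= M.
Proof.
move=> M0 sx p1 p2; have [S [z zE]] := normal_commset (sa_normal sx).
have sz : sa z by apply: val_inj; rewrite /= zE.
rewrite -zE; apply: (@nm_abs _ (bicommutant_algebra S) _ z) => //.
  by apply/pos_val; rewrite /= zE.
by apply/pos_val; rewrite /= zE.
Qed.

Lemma positive_sum0 (I : finType) (F : I -> A) i :
  (forall i, positive (F i)) -> \sum_i F i = 0 -> F i = 0.
Proof.
move=> pF F0; apply: anorm_eq0; apply/eqP; rewrite eq_le anorm_ge0 andbT.
apply: anorm_le_positive => //; rewrite rmorph0 scale0r -F0 (bigD1 i) //=.
by rewrite addrAC subrr add0r; exact: positive_sum.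
Qed.

Lemma sqr_eq0 s : star s = s -> (s * s)%g = 0 -> s = 0.
Proof.
move=> ss e; have : anorm s ^+ 2 = 0 by rewrite -anorm_star ss e /anorm normr0.
by move/eqP; rewrite sqrf_eq0 => /eqP/anorm_eq0.
Qed.

Section UnitSphere.
Variables (n : nat) (a : 'I_n.+1 -> A).
Hypothesis na : forall i, normal (a i).
Hypothesis a1 : \sum_i (a i * star (a i))%g = 1%g.

Lemma sphere_norm_le1 i : anorm (a i) <= 1.
Proof.
rewrite -(@ler_pXn2r _ 2) ?nnegrE ?anorm_ge0 // expr1n -anorm_star na.
apply: anorm_le_positive => //; first exact: positive_normal.
rewrite rmorph1 scale1r -a1 (bigD1 i) //= addrAC subrr add0r.
by apply: positive_sum => j; exact: positive_normal.
Qed.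

Lemma mul_suml (I : finType) (F : I -> A) x : ((\sum_i F i)%R * x)%g = \sum_i (F i * x)%g.
Proof. by elim/big_rec2: _ => [|i u v _ <-]; rewrite ?smul0l ?cmulDl. Qed.
Lemma mul_sumr (I : finType) (F : I -> A) x : (x * (\sum_i F i)%R)%g = \sum_i (x * F i)%g.
Proof. by elim/big_rec2: _ => [|i u v _ <-]; rewrite ?smul0 ?cmulDr. Qed.

Hypothesis comm : forall i j, (a i * a j = a j * a i)%g.

(* Fuglede's theorem in this special case: with [d i j] the commutator of
   [star (a j)] and [a i], we have [star (d i j) = d j i], and expanding the sum
   of all [d j i * d i j] gives [1 - 1 - 1 + 1 = 0]. *)
Lemma sphere_comm_star i j : (a i * star (a j) = star (a j) * a i)%g.
Proof.
pose d i j : A := (star (a j) * a i)%g - (a i * star (a j))%g.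
have b1 : \sum_i (star (a i) * a i)%g = 1%g by rewrite -a1; apply: eq_bigr => l _; exact: na.
have commS p q : (star (a p) * star (a q) = star (a q) * star (a p))%g.
  by rewrite -!starM comm.
have sd p q : star (d p q) = d q p by rewrite /d starD starN !starM !starK.
have d0 : \sum_p \sum_q (d q p * d p q)%g = 0.
  have -> : \sum_p \sum_q (d q p * d p q)%g =
     \sum_p \sum_q ((star (a p) * ((a q * star (a q)) * a p))%g
       - ((star (a p) * a p) * (a q * star (a q)))%g
       - ((a q * star (a q)) * (star (a p) * a p))%g
       + (a q * ((star (a p) * a p) * star (a q)))%g).
    apply: eq_bigr => p _; apply: eq_bigr => q _.
    rewrite /d smulBl !smulBr opprB addrA.
    have -> : (star (a p) * a q * (a p * star (a q)) =
      star (a p) * a p * (a q * star (a q)))%g.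
      by rewrite -!mulgA; congr (_ * _)%g; rewrite !mulgA comm.
    have -> : (a q * star (a p) * (star (a q) * a p) =
      a q * star (a q) * (star (a p) * a p))%g.
      by rewrite -!mulgA; congr (_ * _)%g; rewrite !mulgA commS.
    by rewrite -!mulgA addrAC.
  rewrite (eq_bigr (fun p => (star (a p) * a p)%g - (star (a p) * a p)%g
       - (star (a p) * a p)%g + \sum_q (a q * ((star (a p) * a p) * star (a q)))%g)).
    rewrite big_split /= !sumrB b1 subrr sub0r exchange_big /=.
    rewrite (eq_bigr (fun q => (a q * star (a q))%g)) => [|q _]; first by rewrite a1 addNr.
    by rewrite -mul_sumr -mul_suml b1 mul1g.
  move=> p _; rewrite big_split /= !sumrB -!mul_sumr -!mul_suml a1.
  by rewrite mul1g mulg1 mul1g.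
have dE : d i j = (star (a j) * a i)%g - (a i * star (a j))%g by [].
clearbody d.
pose D (p : 'I_n.+1 * 'I_n.+1) : A := d p.1 p.2 + d p.2 p.1.
pose E (p : 'I_n.+1 * 'I_n.+1) : A := ('i%C : C) *: (d p.1 p.2 - d p.2 p.1).
have sD p : star (D p) = D p by rewrite /D starD !sd addrC.
have sE p : star (E p) = E p.
  rewrite /E starZ starD starN !sd.
  have -> : ('i%C : C)^* = - 'i%C.
    by apply/eqP; rewrite eq_complex /= oppr0 !eqxx.
  by rewrite scaleNr -scalerN opprB.
have DE0 : \sum_p ((D p * D p)%g + (E p * E p)%g) = 0.
  have ii : ('i%C : C) * 'i%C = -1 by rewrite -expr2 sqr_i.
  rewrite (eq_bigr (fun p : 'I_n.+1 * 'I_n.+1 => ((d p.2 p.1 * d p.1 p.2)%g +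
    (d p.1 p.2 * d p.2 p.1)%g) *+ 2)); last first.
    move=> p _; rewrite /D /E -cscaleAl -cscaleAr scalerA ii scaleN1r.
    set x := d _ _; set y := d _ _.
    rewrite smulBl !smulBr cmulDl !cmulDr.
    exact: polarization_sum.
  rewrite sumrMnl big_split /= -(pair_bigA _ (fun p q => (d q p * d p q)%g)) /= d0 add0r.
  rewrite -(pair_bigA _ (fun p q => (d p q * d q p)%g)) /= exchange_big /= d0.
  by rewrite mul0rn.
have pDE p : positive ((D p * D p)%g + (E p * E p)%g).
  by apply: positiveD; apply: positive_sqr.
have := positive_sum0 (i, j) pDE DE0 => de0.
(* [D^2 + E^2] is read as a sum over [bool], so that [positive_sum0] separates the two squares. *)
have pos2 (b : bool) : positive (if b then (D (i, j) * D (i, j))%g else (E (i, j) * E (i, j))%g).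
  by case: b; apply: positive_sqr.
have := positive_sum0 _ pos2; rewrite big_bool /= => /(_ _ de0) z.
have Dz := sqr_eq0 (sD _) (z true); have Ez := sqr_eq0 (sE _) (z false).
have /eqP := Ez; rewrite scaler_eq0 => /orP[/eqP|].
  by move=> /(congr1 (@complex.Im R)) /= /eqP; rewrite oner_eq0.
rewrite subr_eq0 => /eqP /= dd; move: Dz; rewrite /D /= -dd => /eqP.
by rewrite -mulr2n -scaler_nat scaler_eq0 pnatr_eq0 /= dE subr_eq0 => /eqP ->.
Qed.
End UnitSphere.
End PositiveElements.

(** * Functional calculus and equivariance *)

Section Actions.
Variables (R : realType) (G : topGroupType) (A : cstarAlgType R).
Variable alpha : cstar_action G A.
Local Notation C := (Cx R).
Implicit Types (g : G) (x : A).

Lemma actK g x : alpha g^-1%g (alpha g x) = x.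
Proof. by rewrite -actM mulVg act1. Qed.
Lemma actKV g x : alpha g (alpha g^-1%g x) = x.
Proof. by rewrite -actM mulgV act1. Qed.
Lemma actN g x : alpha g (- x) = - alpha g x.
Proof. by rewrite -scaleN1r act_scale scaleN1r. Qed.

Lemma act_positive g x : positive x -> positive (alpha g x).
Proof.
move=> /positive_sqrt[s ss ->]; rewrite act_mul.
by apply: positive_sqr; rewrite -act_star ss.
Qed.

(** An automorphism preserves squares of self-adjoint elements, hence positivity, hence the bounds
    [M - z] and [M + z] that control the norm of a self-adjoint [z]. The C*-identity reduces [x] to
    [star x * x], and the inverse automorphism gives equality. *)
Lemma act_anorm g x : anorm (alpha g x) = anorm x.
Proof.
suff le h y : anorm (alpha h y) <= anorm y.
  by apply/eqP; rewrite eq_le le -{1}(actK g x) le.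
have le_sa z : star z = z -> anorm (alpha h z) <= anorm z.
  move=> sz; have [p1 p2] := positive_near sz (lexx _).
  apply: anorm_le_abs; rewrite ?anorm_ge0 -?act_star ?sz //.
    by have := act_positive h p1; rewrite act_add actN act_scale act_one.
  by have := act_positive h p2; rewrite act_add act_scale act_one.
rewrite -(@ler_pXn2r _ 2) ?nnegrE ?anorm_ge0 // -!anorm_star -act_star -act_mul.
by apply: le_sa; rewrite starM starK.
Qed.
End Actions.

Section FunctionalCalculus.
Variables (R : realType) (A : cstarAlgType R).
Local Notation C := (Cx R).
Variables (m : nat) (a : 'I_m.+1 -> A) (X : Type) (k : X -> 'I_m.+1 -> C).
Hypothesis comm : forall i j, (a i * a j = a j * a i)%g.
Hypothesis comm_star : forall i j, (a i * star (a j) = star (a j) * a i)%g.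
Hypothesis norm_a : forall j, anorm (a j) <= 1.
Hypothesis k_bound : forall x j, modulus (k x j) <= 1.

(* The values of [k] fill the sphere or the ball in which the joint spectrum lies. *)
Definition fullness : Prop :=
  (\sum_j (a j * star (a j))%g = 1%g /\
     forall w, sqnorm w = 1 -> exists x, k x = w) \/
  (positive (1%g - \sum_j (a j * star (a j))%g) /\
     forall w, sqnorm w <= 1 -> exists x, k x = w).
Hypothesis full : fullness.

Let S := family_commset comm comm_star.
Let B := bicommutant_algebra S.
Let b : 'I_m.+1 -> B := family_elt comm comm_star.

Let val_sum (I : finType) (F : I -> B) :
  val (\sum_i F i : bicomm S) = \sum_i val (F i : bicomm S).
Proof. by elim/big_rec2: _ => // i u v _ <-. Qed.

Let val_norm : val (\sum_j @cadj _ B (b j) * b j : bicomm S) = \sum_j (a j * star (a j))%g.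
Proof. by rewrite val_sum; apply: eq_bigr => j _ /=; rewrite -comm_star. Qed.

Let retract : forall z, exists x, pos (4 * dist2 b z - dist2 b (k x)).
Proof.
case: full => -[h1 h2] z.
  by apply: retract_sphere h2 z; apply: val_inj; rewrite val_norm.
apply: retract_ball h2 z; apply/pos_val.
by rewrite /= -/(val _) val_norm.
Qed.

Let nb j : @cnm _ B (b j) <= 1.
Proof. exact: norm_a. Qed.

Let calcA f x := exists2 y : B, calc b k f y & x = val (y : bicomm S).

(** Total in [f], with the default 0; admissible functions always have a value. *)
Definition calculus (f : X -> C) : A :=
  match pselect (exists x, calcA f x) with
  | left h => projT1 (cid h)
  | right _ => 0
  end.

Let calculusP f x : calcA f x -> calculus f = x.
Proof.
rewrite /calculus; case: pselect => [h|h cx]; last by exfalso; apply: h; exists x.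
case: (cid h) => y /= [y' cy ->] [x' cx ->].
by rewrite (calc_uniq nb retract cy cx).
Qed.

Let calculus_ex f : admissible k f ->
  exists2 y : B, calc b k f y & calculus f = val (y : bicomm S).
Proof.
move=> /(calc_ex nb retract)[y cy]; exists y => //.
by apply: calculusP; exists y.
Qed.

Lemma calculusD f g : admissible k f -> admissible k g ->
  calculus (fun p => f p + g p) = calculus f + calculus g.
Proof.
move=> /calculus_ex[y cy ->] /calculus_ex[z cz ->]; apply: calculusP.
by exists (y + z) => //; exact: calc_add.
Qed.

Lemma calculusZ c f : admissible k f -> calculus (fun p => c * f p) = c *: calculus f.
Proof.
move=> /calculus_ex[y cy ->]; apply: calculusP; exists (csc B c * y); first exact: calc_scale.
by rewrite /= -cscaleAl mul1g.
Qed.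

Lemma calculusM f g : admissible k f -> admissible k g ->
  calculus (fun p => f p * g p) = (calculus f * calculus g)%g.
Proof.
move=> af ag; have [y cy ->] := calculus_ex af; have [z cz ->] := calculus_ex ag.
by apply: calculusP; exists (y * z) => //; exact: (calc_mul retract k_bound).
Qed.

Lemma calculus_star f : admissible k f -> calculus (fun p => (f p)^*) = star (calculus f).
Proof.
move=> /calculus_ex[y cy ->]; apply: calculusP.
by exists (@cadj _ B y) => //; exact: calc_star.
Qed.

Lemma calculus1 : calculus (fun=> 1) = 1%g.
Proof. by apply: calculusP; exists 1 => //; exact: calc_one. Qed.

Lemma calculus_coord j : calculus (k^~ j) = a j.
Proof. by apply: calculusP; exists (b j) => //; exact: calc_coord. Qed.

Variables (G : topGroupType) (alpha : cstar_action G A).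

Lemma calculus_equivariant (chi : G -> C) (tau : G -> X -> X) (f : X -> C) g :
  (forall g, chi g * chi g^-1%g = 1) -> (forall g, (chi g)^* * chi g = 1) ->
  (forall g j, alpha g (a j) = chi g *: a j) ->
  (forall g x j, k (tau g x) j = chi g * k x j) -> admissible k f ->
  calculus (f \o tau g) = alpha g (calculus f).
Proof.
move=> chiV chiC aa kt af; have [y cy ->] := calculus_ex af.
(* Each [a j] is an eigenvector of [alpha h], so the commutant of the family, and then its
   bicommutant, are stable; [beta] is the restriction of [alpha g] to the latter. *)
have acomm h (z : A) : commutant S z -> commutant S (alpha h z).
  move=> hz x [j e].
  have c0 : chi h * chi h^-1%g = 1 := chiV h.
  have aE : a j = alpha h (chi h^-1%g *: a j) by rewrite act_scale aa scalerA mulrC c0 scale1r.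
  have zj : commutant S z -> (z * (chi h^-1%g *: a j)%R = (chi h^-1%g *: a j)%R * z)%g.
    by move=> _; rewrite -cscaleAr hz -?cscaleAl //; exists j; left.
  case: e => ->.
    by rewrite aE -!act_mul zj.
  rewrite aE -act_star -!act_mul starZ -cscaleAr hz -?cscaleAl //.
  by exists j; right.
have bact h (x : A) : bicommutant S x -> bicommutant S (alpha h x).
  move=> bx z cz; rewrite -(actKV alpha h z) -!act_mul bx //; exact: acomm.
pose beta (x : bicomm S) : bicomm S := mk_bicomm (bact g _ (bicommP x)).
have betaB : zmod_morphism beta.
  by move=> u v; apply: val_inj; rewrite /= act_add actN.
have betaM : monoid_morphism beta.
  by split=> [|u v]; apply: val_inj; rewrite /= ?act_one ?act_mul.
pose ba := GRing.isZmodMorphism.Build _ _ beta betaB.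
pose bm := GRing.isMonoidMorphism.Build _ _ beta betaM.
pose bh : {rmorphism bicomm S -> bicomm S} := HB.pack beta ba bm.
apply: calculusP; exists (beta y) => //.
apply: (@calc_equivariant _ B _ b nb _ k retract bh (chi g) (chi g^-1%g) (tau g) (tau g^-1%g)) => //.
- by move=> x; exact: act_anorm.
- by move=> x; apply: val_inj; rewrite /= -act_star.
- by move=> s; apply: val_inj; rewrite /= act_scale act_one.
- by move=> j; apply: val_inj; rewrite /= aa -cscaleAl mul1g.
Qed.

End FunctionalCalculus.

(** * Compactness and admissible functions *)

Section ContinuityTools.
Variable R : realType.
Local Notation C := (Cx R).

Lemma continuous_modulusP (X : topologicalType) (f : X -> C) :
  continuous f <-> forall x (e : R), 0 < e -> \forall y \near x, modulus (f y - f x) < e.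
Proof.
split=> [cf x e e0|h x].
  have e0' : (0 : C) < (e%:C)%C by rewrite -(rmorph0 (@real_complex R)) ltcR.
  have /cvgrPdist_lt/(_ _ e0') := cf x; apply: filterS => y.
  by move=> fxy; rewrite -ltcR -modulusE distrC.
apply/cvgrPdist_lt => e e0.
have e' : e = ((complex.Re e)%:C)%C by rewrite RRe_real // ger0_real // ltW.
have {}e0 : 0 < complex.Re e by rewrite -ltcR -e'.
apply: filterS (h x _ e0) => y.
by move=> fxy; rewrite distrC modulusE e' ltcR.
Qed.

Lemma near_modulus (x : C) (e : R) : 0 < e -> \forall y \near x, modulus (y - x) < e.
Proof.
by move: x e; apply/(continuous_modulusP (@id C)) => y; exact: cvg_id.
Qed.

Lemma continuous_lipschitz (f : C -> C) :
  (forall x y, modulus (f x - f y) <= modulus (x - y)) -> continuous f.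
Proof.
move=> h; apply/continuous_modulusP => x e e0.
by apply: (@filterS _ _ (nbhs_filter (x : C)) _ _ _ (near_modulus x e0)) => y /(le_lt_trans (h _ _)).
Qed.

Lemma continuous_conj : continuous (fun x : C => x^*).
Proof. by apply: continuous_lipschitz => x y; rewrite -rmorphB /modulus norm_conjC. Qed.

Lemma continuous_modulus : continuous (@modulus R : C -> R).
Proof.
move=> x; apply/(@cvgrPdist_lt R R^o C (nbhs (x : C))) => e e0.
apply: (@filterS _ _ (nbhs_filter (x : C)) _ _ _ (near_modulus x e0)) => y /le_lt_trans; apply.
have m1 := modulusD (x - y) y; have m2 := modulusD (y - x) x.
rewrite subrK in m1; rewrite subrK in m2.
have e1 : modulus (x - y) = modulus (y - x) by rewrite /modulus distrC.
rewrite e1 in m1; rewrite ler_norml; lra.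
Qed.

Lemma continuous_modulus_comp (X : topologicalType) (f : X -> C) :
  continuous f -> continuous (fun x => modulus (f x)).
Proof.
by move=> cf x; apply: (@cvg_comp _ _ _ f (@modulus R) _ _ _ (cf x)); exact: continuous_modulus.
Qed.

Lemma continuous_real_complex : continuous (fun t : R => (t%:C)%C : C).
Proof.
apply/continuous_modulusP => x e e0.
have /cvgrPdist_lt/(_ _ e0) : id y @[y --> x] --> x by exact: cvg_id.
by apply: filterS => y; rewrite -rmorphB modulus_real distrC.
Qed.

Lemma continuous_sum (X : topologicalType) (I : Type) (r : seq I) (P : pred I)
    (K : numFieldType) (V : normedModType K) (F : I -> X -> V) :
  (forall i, continuous (F i)) -> continuous (fun x => \sum_(i <- r | P i) F i x).
Proof.
move=> cF; elim: r => [|i r ih].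
  rewrite (_ : (fun=> _) = cst 0); first exact: cst_continuous.
  by apply/funext => x; rewrite big_nil.
case Pi: (P i); last first.
  rewrite (_ : (fun=> _) = (fun x => \sum_(j <- r | P j) F j x)) //.
  by apply/funext => x; rewrite big_cons Pi.
rewrite (_ : (fun=> _) = (fun x => F i x + \sum_(j <- r | P j) F j x)).
  by move=> x; apply: cvgD; [exact: cF|exact: ih].
by apply/funext => x; rewrite big_cons Pi.
Qed.

Lemma compact_set_type (X : topologicalType) (A : set X) :
  compact A -> compact [set: A].
Proof.
move=> cA F FF _.
have [|x [Ax cx]] := cA (val @ F) _ .
  by apply: (@filterS _ F _ setT) filterT => y _; exact: set_valP.
exists (exist _ x (mem_set Ax)); split => // U V FU [_ [[W oW <-] Wx sW]].
have [||_ [[y Uy <-] Wy]] := cx (val @` U) W.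
- by apply: (@filterS _ F _ U) FU => y Uy; exists y.
- exact: open_nbhs_nbhs.
- by exists y; split => //; exact: sW.
Qed.

(* On the compact square of [X], the pairs separated by at least [e] under [f]
   keep a positive distance under [k]. *)
Lemma compact_admissible (X : topologicalType) (m : nat) (k : X -> 'I_m.+1 -> C)
    (f : X -> C) :
  compact [set: X] -> (forall j, continuous (k^~ j)) -> continuous f ->
  (forall p q, k p = k q -> f p = f q) -> admissible k f.
Proof.
move=> cX ck cf kf e e0.
pose F (p : X * X) := modulus (f p.1 - f p.2).
pose D (p : X * X) := sqdist (k p.1) (k p.2).
have cdiff (h : X -> C) : continuous h -> continuous (fun p : X * X => modulus (h p.1 - h p.2)).
  move=> ch; apply: continuous_modulus_comp => p; apply: cvgB; (apply: (@cvg_comp _ _ _ _ h); last exact: ch); [exact: cvg_fst|exact: cvg_snd].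
have cF : continuous F by exact: cdiff.
have cD : continuous D.
  pose d j (p : X * X) : R^o := modulus (k p.1 j - k p.2 j).
  rewrite (_ : D = fun p => \sum_j d j p * d j p); last first.
    by apply/funext => p; apply: eq_bigr => j _; rewrite expr2.
  apply: (@continuous_sum _ _ _ _ R R^o (fun j p => d j p * d j p)) => j p.
  by apply: cvgM; exact: (cdiff _ (ck j)).
pose E := [set p : X * X | e <= F p].
have cXX : compact [set: X * X] by rewrite -setXTT; exact: compact_setX.
have cE : compact E.
  apply: subclosed_compact cXX _ => //.
  have -> : E = F @^-1` [set t | e <= t] by [].
  by apply: closed_comp => [p _|]; [exact: cF|exact: closed_ge].
have [E0|/set0P/negP/negPn/eqP E0] := pselect (E !=set0); last first.
  exists 0 => // p q; rewrite mul0r addr0 leNgt; apply/negP => h.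
  by have : E (p, q) by [exact: ltW]; rewrite E0.
have [c cE' hc] := compact_EVT_min E0 cE (continuous_subspaceT cD).
have [d _ hd] := compact_EVT_max E0 cE (continuous_subspaceT cF).
have Ec : E c by move/set_mem : cE'.
have Dc : 0 < D c.
  rewrite lt_neqAle sqdist_ge0 andbT; apply/eqP => D0.
  have kk : k c.1 = k c.2.
    apply/funext => j; apply/eqP; rewrite -subr_eq0 -normr_eq0 modulusE.
    have := esym D0; rewrite /D /sqdist => /eqP.
    rewrite psumr_eq0 => [|i _]; last exact: sqr_ge0.
    by move=> /allP/(_ j (mem_index_enum _)); rewrite sqrf_eq0 => /eqP ->.
  by move: Ec; rewrite /E /F /= (kf _ _ kk) subrr /modulus normr0 leNgt e0.
(* [F d] is the largest variation of [f] on [E] and [D c > 0] the least squared distance there, so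
   on [E] the variation is at most [F d / D c] times the squared distance. *)
exists (F d / D c); first by apply: divr_ge0; [exact: modulus_ge0|exact: ltW].
move=> p q; have [h|h] := lerP (modulus (f p - f q)) e.
  apply: (le_trans h); rewrite lerDl mulr_ge0 ?sqdist_ge0 //.
  by apply: divr_ge0; [exact: modulus_ge0|exact: ltW].
have Epq : (p, q) \in E by apply/mem_set/ltW.
apply: (@le_trans _ _ (F d)); first exact: (hd _ Epq).
rewrite -[X in X <= _]add0r lerD ?(ltW e0) //.
rewrite mulrAC ler_pdivlMr // ler_wpM2l ?modulus_ge0 //; exact: (hc _ Epq).
Qed.

Lemma admissible_conj (X : Type) (m : nat) (k : X -> 'I_m.+1 -> C) (f : X -> C) :
  admissible k f -> admissible k (fun p => (f p)^*).
Proof.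
move=> af e /af[K K0 hK]; exists K => // p q.
by rewrite -rmorphB modulus_conj.
Qed.

Lemma compact_circle : compact [set: circle R].
Proof.
apply: compact_set_type.
pose Q : set C := (fun p : R * R => (p.1%:C)%C + 'i%C * (p.2%:C)%C) @` (`[-1, 1] `*` `[-1, 1]).
have cQ : compact Q.
  apply: continuous_compact; last by apply: compact_setX; exact: segment_compact.
  apply: continuous_subspaceT => p; apply: cvgD.
    by apply: (@cvg_comp _ _ _ _ (fun t : R => (t%:C)%C : C)); [exact: cvg_fst|exact: continuous_real_complex].
  apply: cvgM; first exact: cvg_cst.
  by apply: (@cvg_comp _ _ _ _ (fun t : R => (t%:C)%C : C)); [exact: cvg_snd|exact: continuous_real_complex].
apply: subclosed_compact cQ _.
  have -> : [set z : C | `|z| = 1] = (@modulus R : C -> R) @^-1` [set 1].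
    apply/seteqP; split => z /=; first by rewrite /modulus => ->.
    by rewrite modulusE => ->.
  by apply: closed_comp => [p _|]; [exact: continuous_modulus|exact: closed_eq].
move=> z /= z1; exists (complex.Re z, complex.Im z) => /=; last by rewrite -complexE.
have m1 : modulus z = 1 by rewrite /modulus z1.
have [] := modulus_ReIm z; rewrite m1 !ler_norml => /andP[h1 h2] /andP[h3 h4].
by split; rewrite /= in_itv /= ?h1 ?h2 ?h3 ?h4.
Qed.

Lemma compact_unit_itv : compact [set: unit_itv R].
Proof. by apply: compact_set_type; exact: segment_compact. Qed.

End ContinuityTools.

Lemma conj_real_complex (R : realType) (t : R) : ((t%:C)%C : Cx R)^* = (t%:C)%C.
Proof. by rewrite conj_Creal // complex_real. Qed.

(** * The cone over the circle *)

Section CircleCharacter.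
Variables (R : realType) (gamma : circle R -> circle R).
Hypothesis hgamma : dual_generator gamma.
Local Notation C := (Cx R).
Local Notation gv h := (\val (gamma h) : C).

Lemma gvM g h : gv (g * h)%g = gv g * gv h.
Proof. by rewrite hgamma.1.2. Qed.

Lemma gv_modulus h : modulus (gv h) = 1.
Proof. by rewrite /modulus circle_norm. Qed.

Lemma gv_conj h : (gv h)^* * gv h = 1.
Proof. by rewrite -normCKC circle_norm expr1n. Qed.

Lemma gv1 : gv 1%g = 1.
Proof. by apply: (mulfI (circle_neq0 (gamma 1%g))); rewrite -gvM mulg1 mulr1. Qed.

Lemma gvV h : gv h * gv h^-1%g = 1.
Proof. by rewrite -gvM mulgV gv1. Qed.

Lemma gv_continuous : continuous (fun h => gv h).
Proof.
move=> h; apply: (@cvg_comp _ _ _ gamma (\val : circle R -> C)); first exact: hgamma.1.1.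
exact: circle_val_continuous.
Qed.

(** The identity of the circle is a character, hence a power of the generator [gamma]; both
    injectivity and surjectivity of [gamma] follow. *)
Lemma gv_exponent : exists k : int, forall h, \val h = gv h ^ k.
Proof. by apply: hgamma.2; split=> // x; exact: cvg_id. Qed.

Lemma gv_inj g h : gv g = gv h -> g = h.
Proof. by have [k hk] := gv_exponent => e; apply: val_inj; rewrite (hk g) (hk h) e. Qed.

(** Seen as a point [h] of the circle, [w] equals [gamma(h)^k = gamma(h^k)]. *)
Lemma gv_surj (w : C) : modulus w = 1 -> exists h, gv h = w.
Proof.
have [k hk] := gv_exponent; rewrite /modulus => w1.
have nw : `|w| = 1 by rewrite modulusE /modulus w1.
pose h := mk_circle nw; have hw : \val h = w by [].
have gvX g n : gv (g ^+ n)%g = gv g ^+ n.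
  by elim: n => [|n ih]; rewrite ?expg0 ?gv1 ?expr0 // expgS gvM ih exprS.
case: k hk => n hk; first by exists (h ^+ n)%g; rewrite gvX exprnP -hk.
exists ((h^-1) ^+ n.+1)%g; rewrite gvX -hw (hk h) NegzE -exprnN -exprVn; congr (_ ^+ _).
have g0 := circle_neq0 (gamma h).
by apply: (mulfI g0); rewrite gvV mulfV.
Qed.

Lemma unit_ray (r : R) (c : C) : modulus c = r -> exists h, c = (r%:C)%C * gv h.
Proof.
move=> cr; have [r0|r0] := eqVneq r 0.
  by exists 1%g; rewrite r0 mul0r; apply/eqP; rewrite -normr_eq0 modulusE cr r0.
have rp : 0 <= r by rewrite -cr modulus_ge0.
have [|h hE] := gv_surj (w := ((r^-1)%:C)%C * c).
  by rewrite modulusM modulus_real cr ger0_norm ?invr_ge0 // mulVf.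
by exists h; rewrite hE mulrA -rmorphM mulfV // mul1r.
Qed.

Section Cone.

Lemma half1_subproof : 1 \in [set` `]0, (1 : R)]%R].
Proof. by apply/mem_set; rewrite /= in_itv /= ltr01 lexx. Qed.
Definition half1 : half_open R := exist _ 1 half1_subproof.
Definition to_half (t : R) : half_open R := insubd half1 t.

Lemma to_halfK (t : R) : 0 < t -> t <= 1 -> \val (to_half t) = t.
Proof. by move=> t0 t1; rewrite val_insubd ifT //; apply/mem_set; rewrite /= in_itv /= t0 t1. Qed.

Lemma half_gt0 (t : half_open R) : 0 < \val t.
Proof. by have := set_valP t; rewrite /= in_itv /= => /andP[]. Qed.
Lemma half_le1 (t : half_open R) : \val t <= 1.
Proof. by have := set_valP t; rewrite /= in_itv /= => /andP[]. Qed.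
Lemma val_half (t : half_open R) : to_half (\val t) = t.
Proof. by apply: val_inj; rewrite to_halfK ?half_gt0 ?half_le1. Qed.

Lemma itv_ge0 (t : unit_itv R) : 0 <= \val t.
Proof. by have := set_valP t; rewrite /= in_itv /= => /andP[]. Qed.
Lemma itv_le1 (t : unit_itv R) : \val t <= 1.
Proof. by have := set_valP t; rewrite /= in_itv /= => /andP[]. Qed.

Lemma itv_val_continuous : continuous (\val : unit_itv R -> R).
Proof. exact: initial_continuous. Qed.
Lemma half_val_continuous : continuous (\val : half_open R -> R).
Proof. exact: initial_continuous. Qed.

(** Continuity at 0 is the vanishing at infinity: a compact subset of (0, 1] is closed in the line
    and misses 0, so a neighbourhood of 0 avoids it. *)
Lemma cont0_extend (u : half_open R -> C) : Cont0 u ->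
  continuous (fun t : unit_itv R => if 0 < \val t then u (to_half (\val t)) else 0).
Proof.
move=> [cu vu]; apply/continuous_modulusP => t0 e e0.
have [t00|t00] := ltrP 0 (\val t0).
  have [_ [[W oW <-] Wx sW]] := (continuous_modulusP u).1 cu (to_half (\val t0)) e e0.
  have tt : \val (to_half (\val t0)) = \val t0 by rewrite to_halfK ?itv_le1.
  have n1 : nbhs (\val t0) W by rewrite -tt; exact: open_nbhs_nbhs.
  have n2 : nbhs (\val t0) [set t : R | 0 < t] by apply: open_nbhs_nbhs; split; [exact: open_gt|].
  have n3 : nbhs t0 (\val @^-1` (W `&` [set t : R | 0 < t])).
    exact: (@itv_val_continuous t0 _ (filterI n1 n2)).
  apply: filterS n3 => t /= [Wt t_gt0]; rewrite t_gt0.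
  have Wt' : W (\val (to_half (\val t))) by rewrite to_halfK ?itv_le1.
  exact: (sW (to_half (\val t)) Wt').
have [K cK hK] := vu e e0.
have cl : closed (\val @` K : set R).
  apply: compact_closed; first exact: Rhausdorff.
  by apply: continuous_compact => //; apply: continuous_subspaceT; exact: half_val_continuous.
have n1 : nbhs (\val t0) (~` (\val @` K : set R)).
  apply: open_nbhs_nbhs; split; first exact: closed_openC.
  by move=> [s _ es]; have := half_gt0 s; rewrite es ltNge t00.
have n2 : nbhs t0 (\val @^-1` (~` (\val @` K : set R))).
  exact: (@itv_val_continuous t0 _ n1).
apply: filterS n2 => t /= tK.
rewrite subr0; case: ifPn => [t_gt0|_]; last by rewrite /modulus normr0.
rewrite -ltcR -modulusE; apply: hK => Kt; apply: tK; exists (to_half (\val t)) => //.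
by rewrite to_halfK ?itv_le1.
Qed.

Definition cone_extend (f : half_open R * circle R -> C) (p : unit_itv R * circle R) : C :=
  if 0 < \val p.1 then f (to_half (\val p.1), p.2) else 0.

Lemma cone_extend_continuous f : cone_alg (R := R) (G := circle R) f ->
  continuous (cone_extend f).
Proof.
move=> cf; apply/continuous_modulusP => p e e0.
have e3 : 0 < e / 3 by lra.
have [n [u [v [huv huv']]]] := cf _ e3.
pose g (q : unit_itv R * circle R) : C :=
  \sum_i (if 0 < \val q.1 then u i (to_half (\val q.1)) else 0) * v i q.2.
have cg : continuous g.
  apply: (@continuous_sum _ _ _ _ C C^o (fun i (q : unit_itv R * circle R) =>
    (if 0 < \val q.1 then u i (to_half (\val q.1)) else 0) * v i q.2)) => i.
  have [ui vi] := huv i.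
  apply: Cx_continuousM => q.
    by apply: (@cvg_comp _ _ _ fst (fun t : unit_itv R =>
      if 0 < \val t then u i (to_half (\val t)) else 0 : C)); [exact: cvg_fst|exact: cont0_extend].
  by apply: (@cvg_comp _ _ _ snd (v i)); [exact: cvg_snd|exact: vi].
have fg q : modulus (cone_extend f q - g q) <= e / 3.
  rewrite /cone_extend /g; case: ifPn => h.
    by rewrite -lecR -modulusE; exact: huv'.
  rewrite big1 => [|i _]; last by rewrite mul0r.
  by rewrite subrr /modulus normr0 ltW.
have := (continuous_modulusP g).1 cg p _ e3.
apply: filterS => q hq.
have -> : cone_extend f q - cone_extend f p =
  (cone_extend f q - g q) + ((g q - g p) + (g p - cone_extend f p)) by ring.
apply: le_lt_trans (modulusD _ _) _.
have m1 := modulusD (g q - g p) (g p - cone_extend f p).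
have m2 : modulus (g p - cone_extend f p) <= e / 3 by rewrite /modulus distrC; exact: fg.
have m3 := fg q; lra.
Qed.

(** The square root makes the squared modulus equal to [t], so that [t] is sent to [a * star a]. The
    image is the closed unit disc. *)
Definition cone_coord (p : unit_itv R * circle R) (_ : 'I_1) : C :=
  ((Num.sqrt (\val p.1))%:C)%C * gv p.2.

Lemma sqrt_itv_continuous : continuous (fun t : unit_itv R => ((Num.sqrt (\val t))%:C)%C : C).
Proof.
move=> t; apply: (@cvg_comp _ _ _ (fun t : unit_itv R => Num.sqrt (\val t)) (fun t : R => (t%:C)%C : C)).
  by apply: (@cvg_comp _ _ _ (\val : unit_itv R -> R)); [exact: itv_val_continuous|exact: sqrt_continuous].
exact: continuous_real_complex.
Qed.

Lemma cone_coord_continuous j : continuous (cone_coord^~ j).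
Proof.
apply: Cx_continuousM => p.
  by apply: (@cvg_comp _ _ _ fst (fun t : unit_itv R => ((Num.sqrt (\val t))%:C)%C : C));
    [exact: cvg_fst|exact: sqrt_itv_continuous].
by apply: (@cvg_comp _ _ _ snd (fun h => gv h)); [exact: cvg_snd|exact: gv_continuous].
Qed.

Lemma modulus_cone_coord p j : modulus (cone_coord p j) = Num.sqrt (\val p.1).
Proof. by rewrite modulusM gv_modulus mulr1 modulus_real ger0_norm // sqrtr_ge0. Qed.

Lemma cone_coord_bound p j : modulus (cone_coord p j) <= 1.
Proof.
rewrite modulus_cone_coord; apply: (@le_trans _ _ (Num.sqrt 1)); last by rewrite sqrtr1.
by apply: ler_wsqrtr; exact: itv_le1.
Qed.

(** The coordinate collapses the circle over [t = 0], where the extension vanishes; elsewhere it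
    determines [t] by its modulus and then the point of the circle by injectivity of [gamma]. *)
Lemma cone_admissible f : cone_alg (R := R) (G := circle R) f ->
  admissible cone_coord (cone_extend f).
Proof.
move=> cf; apply: compact_admissible.
- by rewrite -setXTT; apply: compact_setX; [exact: compact_unit_itv|exact: compact_circle].
- exact: cone_coord_continuous.
- exact: cone_extend_continuous.
move=> p q e; have e0 := congr1 (fun c => c ord0) e.
have et : \val p.1 = \val q.1.
  have := congr1 (@modulus R) e0; rewrite !modulus_cone_coord => /(congr1 (fun t => t ^+ 2)).
  by rewrite !sqr_sqrtr ?itv_ge0.
rewrite /cone_extend -et; case: ifPn => // t0.
have s0 : ((Num.sqrt (\val p.1))%:C)%C != 0 :> C.
  rewrite -normr_eq0 modulusE modulus_real ger0_norm ?sqrtr_ge0 //.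
  by rewrite gt_eqF // -(rmorph0 (@real_complex R)) ltcR sqrtr_gt0.
by move: e0; rewrite /cone_coord -et => /(mulfI s0)/gv_inj ->.
Qed.

Variables (A : cstarAlgType R) (alpha : cstar_action (circle R) A).

Lemma cone_hom_of_normal (a : A) : normal a -> spectral_subspace alpha gamma a ->
  anorm a <= 1 ->
  exists2 rho, cone_hom (R := R) alpha rho & rho (@cone_t R (circle R)) = (a * star a)%g.
Proof.
move=> na sa na1; pose a' (_ : 'I_1) := a.
have comm (i j : 'I_1) : (a' i * a' j = a' j * a' i)%g by [].
have comm_star (i j : 'I_1) : (a' i * star (a' j) = star (a' j) * a' i)%g by rewrite -na.
have na' (j : 'I_1) : anorm (a' j) <= 1 by [].
have full : fullness a' cone_coord.
  right; split.
    rewrite big_ord1 /a'; have [] := positive_near (x := (a * star a)%g) (M := 1).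
    - by rewrite starM starK.
    - by rewrite -na anorm_star expr_le1 ?anorm_ge0.
    - by rewrite rmorph1 scale1r.
  move=> w; rewrite /sqnorm big_ord1 => w1.
  set r := modulus (w ord0) in w1; have r0 : 0 <= r by exact: modulus_ge0.
  have rT : r ^+ 2 \in [set` `[0, (1 : R)]%R].
    by apply/mem_set; rewrite /= in_itv /= sqr_ge0.
  have [h hw] := unit_ray (erefl r).
  exists (exist _ (r ^+ 2) rT, h); apply/funext => j; rewrite ord1 hw /cone_coord /=.
  by rewrite sqrtr_sqr ger0_norm.
pose rho f := calculus cone_coord comm comm_star (cone_extend f).
have adm := cone_admissible.
exists rho; last first.
  have -> : rho (@cone_t R (circle R)) = calculus cone_coord comm comm_star
      (fun p => cone_coord p ord0 * (cone_coord p ord0)^*).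
    congr (calculus _ _ _ _); apply/funext => p; rewrite -normCK modulusE modulus_cone_coord.
    rewrite -rmorphXn /= sqr_sqrtr ?itv_ge0 // /cone_extend /cone_t.
    case: ifPn => [p0|p0]; first by rewrite to_halfK ?itv_le1.
    suff -> : \val p.1 = 0 by [].
    by apply/eqP; rewrite eq_le itv_ge0 andbT leNgt.
  have ac := admissible_coord cone_coord ord0.
  rewrite (calculusM comm comm_star na' cone_coord_bound full ac (admissible_conj ac)).
  by rewrite (calculus_star comm comm_star na' full ac) (calculus_coord comm comm_star na' full).
split; first split.
- move=> f g Df Dg; rewrite -(calculusD comm comm_star na' full (adm _ Df) (adm _ Dg)).
  congr (calculus _ _ _ _); apply/funext => p; rewrite /cone_extend.
  by case: ifP => _; rewrite ?addr0.
- move=> c f Df; rewrite -(calculusZ comm comm_star na' full c (adm _ Df)).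
  congr (calculus _ _ _ _); apply/funext => p; rewrite /cone_extend.
  by case: ifP => _; rewrite ?mulr0.
- move=> f g Df Dg.
  rewrite -(calculusM comm comm_star na' cone_coord_bound full (adm _ Df) (adm _ Dg)).
  congr (calculus _ _ _ _); apply/funext => p; rewrite /cone_extend.
  by case: ifP => _; rewrite ?mulr0.
- move=> f Df; rewrite -(calculus_star comm comm_star na' full (adm _ Df)).
  congr (calculus _ _ _ _); apply/funext => p; rewrite /cone_extend.
  by case: ifP => _; rewrite ?rmorph0.
move=> g f Df.
pose tau (g : circle R) (p : unit_itv R * circle R) := (p.1, (p.2 * g)%g).
rewrite -(@calculus_equivariant _ _ _ _ _ _ comm comm_star na' full _ alpha
  (fun h => gv h) tau (cone_extend f)) //.
- exact: gvV.
- exact: gv_conj.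
- by move=> h x j; rewrite /cone_coord gvM mulrA [RHS]mulrC.
- exact: adm.
Qed.

Lemma normal_of_hom (X : Type) (tau : circle R -> X -> X) (D : set (X -> C))
    (rho : (X -> C) -> A) (f : X -> C) :
  star_hom D rho -> equivariant tau D alpha rho ->
  D f -> D (fun x => (f x)^*) -> (forall g x, f (tau g x) = gv g * f x) ->
  [/\ normal (rho f), spectral_subspace alpha gamma (rho f) &
      (rho f * star (rho f))%g = rho (fun x => f x * (f x)^*)].
Proof.
move=> [_ rZ rM rS] req Df Dc ft; split.
- rewrite /normal -rS // -!rM //; congr (rho _).
  by apply/funext => x; rewrite mulrC.
- move=> g; rewrite -req // -rZ //; congr (rho _).
  by apply/funext => x; rewrite /= ft.
- by rewrite rM // rS.
Qed.

Lemma cone_elt f g : Cont0 (R := R) (X := half_open R) f -> continuous g ->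
  cone_alg (R := R) (G := circle R) (fun p => f p.1 * g p.2).
Proof.
move=> f0 cg e e0; exists 1%N, (fun=> f), (fun=> g); split => // p.
by rewrite big_ord1 subrr normr0 -(rmorph0 (@real_complex R)) lecR ltW.
Qed.

Lemma cont0_sqrt : Cont0 (fun t : half_open R => ((Num.sqrt (\val t))%:C)%C : C).
Proof.
split.
  move=> t; apply: (@cvg_comp _ _ _ (fun t : half_open R => Num.sqrt (\val t)) (fun t : R => (t%:C)%C : C)).
    by apply: (@cvg_comp _ _ _ (\val : half_open R -> R)); [exact: half_val_continuous|exact: sqrt_continuous].
  exact: continuous_real_complex.
(* Below [d] the square root is less than [e]; the compact set is [d, 1]. *)
move=> e e0; pose d := Num.min 1 (e ^+ 2 / 2).
have d0 : 0 < d by rewrite lt_min ltr01 divr_gt0 // exprn_gt0.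
exists (to_half @` [set t : R | d <= t <= 1]).
  have cd : compact [set t : R | d <= t <= 1].
    have -> : [set t : R | d <= t <= 1] = [set` `[d, 1]].
      by apply/seteqP; split => t /=; rewrite in_itv.
    exact: segment_compact.
  apply: continuous_compact => //; apply/subspace_sigL_continuousP.
  apply: continuous_comp_initial.
  rewrite (_ : _ \o _ = set_val); first exact: initial_continuous.
  apply/funext => t; rewrite /= /sigL; have /andP[t1 t2] := set_valP t.
  exact: (to_halfK (lt_le_trans d0 t1) t2).
move=> t nt; rewrite modulusE modulus_real ltcR ger0_norm ?sqrtr_ge0 //.
have td : \val t < d.
  rewrite ltNge; apply/negP => h; apply: nt; exists (\val t); last exact: val_half.
  by rewrite /= h half_le1.
rewrite -[e]ger0_norm ?(ltW e0) // -sqrtr_sqr ltr_sqrt ?exprn_gt0 //.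
apply: (lt_trans td); rewrite /d gt_min; apply/orP; right.
by have := exprn_gt0 2 e0; lra.
Qed.

Lemma gv_conj_continuous : continuous (fun h => (gv h)^*).
Proof.
move=> h; apply: (@cvg_comp _ _ _ (fun h => gv h) (fun x : C => x^*)); first exact: gv_continuous.
exact: continuous_conj.
Qed.

Lemma normal_of_cone_hom rho : cone_hom (R := R) alpha rho -> exists a : A,
  [/\ normal a, spectral_subspace alpha gamma a & (a * star a)%g = rho (@cone_t R (circle R))].
Proof.
move=> [hr er]; pose f (p : half_open R * circle R) : C := ((Num.sqrt (\val p.1))%:C)%C * gv p.2.
have Df : cone_alg (R := R) (G := circle R) f.
  exact: (cone_elt cont0_sqrt gv_continuous).
have Dfc : cone_alg (R := R) (G := circle R) (fun p => (f p)^*).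
  have -> : (fun p => (f p)^*) = (fun p => ((Num.sqrt (\val p.1))%:C)%C * (gv p.2)^*).
    by apply/funext => p; rewrite /f rmorphM; congr (_ * _); exact: conj_real_complex.
  exact: (cone_elt cont0_sqrt gv_conj_continuous).
have [|na sa e] := normal_of_hom hr er Df Dfc.
  by move=> g p; rewrite /f gvM mulrA [RHS]mulrC.
exists (rho f); split => //; rewrite e; congr (rho _); apply/funext => p.
rewrite -normCK modulusE modulusM gv_modulus mulr1 modulus_real ger0_norm ?sqrtr_ge0 //.
by rewrite -rmorphXn /= sqr_sqrtr // ltW // half_gt0.
Qed.
End Cone.
End CircleCharacter.

(** * Coordinates on iterated joins *)

Section JoinCoordinates.
Variables (R : realType) (gamma : circle R -> circle R).
Hypothesis hgamma : dual_generator gamma.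
Local Notation C := (Cx R).
Local Notation gv h := (\val (gamma h) : C).
Local Notation E n := (EG R (circle R) n).

(** The identification of the iterated join with the unit sphere of [C^(n+1)]: the class of
    [(x, y, t)] goes to [sqrt t] times the coordinates of [x], followed by [sqrt (1 - t) gamma(y)].
    Indices in [nat] keep the recursion free of casts; those beyond [n] repeat the last
    coordinate. *)
Fixpoint join_coord (n : nat) : E n -> nat -> C :=
  match n return E n -> nat -> C with
  | 0 => fun x _ => gv x
  | n'.+1 => fun (p : join R (E n') (Gtranslate (circle R))) j =>
      if (j < n'.+1)%N
      then ((Num.sqrt (\val (repr p).2))%:C)%C * join_coord (repr p).1.1 j
      else ((Num.sqrt (1 - \val (repr p).2))%:C)%C * gv (repr p).1.2
  end.

Lemma join_repr (X Y : topologicalType) (q : X * Y * unit_itv R) :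
  join_rel0 (repr (\pi_(join R X Y)%qT q)) q.
Proof. by have := reprK (\pi_(join R X Y)%qT q) => /eqmodP. Qed.

Lemma join_eq (X Y : topologicalType) (p q : join R X Y) :
  join_rel0 (repr p) (repr q) -> p = q.
Proof. by move=> h; rewrite -[p]reprK -[q]reprK; apply/eqmodP. Qed.

(** Independence of the representative: where the join forgets [x] or [y], the corresponding square
    root vanishes. *)
Lemma join_coordS n (x : E n) (y : circle R) (t : unit_itv R) j :
  join_coord (n := n.+1) (\pi_(join R (E n) (Gtranslate (circle R)))%qT (x, y, t)) j =
  if (j < n.+1)%N then ((Num.sqrt (\val t))%:C)%C * join_coord x j
  else ((Num.sqrt (1 - \val t))%:C)%C * gv y.
Proof.
rewrite /=; have := join_repr (x, y, t : unit_itv R).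
case: (repr _) => [[x' y'] t'] /and3P[/eqP /= <-] hx hy; case: ifP => _.
  by case/orP: hx => /eqP ->; rewrite ?sqrtr0 ?mul0r.
by case/orP: hy => /eqP ->; rewrite ?subrr ?sqrtr0 ?mul0r.
Qed.

Lemma join_coord_sqnorm n (x : E n) : \sum_(j < n.+1) modulus (join_coord x j) ^+ 2 = 1.
Proof.
elim: n x => [|n ih] p; first by rewrite big_ord1 /= (gv_modulus gamma) expr1n.
rewrite big_ord_recr /= ltnn sqr_modulusM (gv_modulus gamma) expr1n mulr1.
rewrite (eq_bigr (fun j : 'I_n.+1 => \val (repr p).2 * modulus (join_coord (repr p).1.1 j) ^+ 2)).
  rewrite -mulr_sumr ih mulr1 sqr_sqrtr ?subr_ge0 ?itv_le1 //.
  by rewrite addrC subrK.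
by move=> j _; rewrite ltn_ord sqr_modulusM sqr_sqrtr ?itv_ge0.
Qed.

Lemma join_coord_head n (p : E n.+1) :
  \sum_(j < n.+1) modulus (join_coord p j) ^+ 2 = \val (repr p).2.
Proof.
have h : \val (repr p).2 * \sum_(j < n.+1) modulus (join_coord (repr p).1.1 j) ^+ 2 =
    \val (repr p).2 by rewrite join_coord_sqnorm mulr1.
rewrite -[RHS]h mulr_sumr; apply: eq_bigr => j _ /=.
by rewrite ltn_ord sqr_modulusM sqr_sqrtr ?itv_ge0.
Qed.

Lemma sqrt_complex_neq0 (t : R) : 0 < t -> ((Num.sqrt t)%:C)%C != 0 :> C.
Proof.
move=> t0; apply/eqP => /(@complexI R _ 0)/eqP; rewrite sqrtr_eq0 leNgt t0 //.
Qed.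

(** The coordinates give [t] by [join_coord_head], then [x] unless [t = 0] and [y] unless [t = 1],
    which is exactly the join relation. *)
Lemma join_coord_inj n (x y : E n) :
  (forall j, (j < n.+1)%N -> join_coord x j = join_coord y j) -> x = y.
Proof.
elim: n x y => [|n ih] p q h; first exact: (gv_inj hgamma (h 0%N isT)).
have et : \val (repr p).2 = \val (repr q).2.
  rewrite -!join_coord_head; apply: eq_bigr => j _; rewrite h //.
  exact: leqW (ltn_ord j).
apply: join_eq; apply/and3P; split; first by apply/eqP/val_inj.
  have [//|t0] := eqVneq (\val (repr p).2) 0; apply/orP; right.
  have {}t0 : 0 < \val (repr p).2 by rewrite lt_neqAle eq_sym t0 itv_ge0.
  apply/eqP/ih => j jn; have := h j (leqW jn); rewrite /= jn -et.
  exact: (mulfI (sqrt_complex_neq0 t0)).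
have [//|t1] := eqVneq (\val (repr p).2) 1; apply/orP; right.
have {}t1 : 0 < 1 - \val (repr p).2 by rewrite subr_gt0 lt_neqAle t1 itv_le1.
have := h n.+1 (ltnSn _); rewrite /= ltnn -et => /(mulfI (sqrt_complex_neq0 t1)) e.
exact/eqP/(gv_inj hgamma).
Qed.

Lemma join_coord_surj n (w : nat -> C) : \sum_(j < n.+1) modulus (w j) ^+ 2 = 1 ->
  exists x : E n, forall j, (j < n.+1)%N -> join_coord x j = w j.
Proof.
elim: n w => [|n ih] w.
  rewrite big_ord1 => /eqP; rewrite sqrf_eq1 => /orP[/eqP|/eqP w1].
    by move=> /(gv_surj hgamma)[h hE]; exists h => -[].
  by have := modulus_ge0 (w 0%N); rewrite w1 lerNr oppr0 leNgt ltr01.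
rewrite big_ord_recr /=; set t := \sum_(j < n.+1) _ => tw.
have t0 : 0 <= t by apply: sumr_ge0 => j _; exact: sqr_ge0.
have s1 : 1 - t = modulus (w n.+1) ^+ 2 by rewrite -tw addrAC subrr add0r.
have t1 : t <= 1 by rewrite -subr_ge0 s1 sqr_ge0.
have tI : t \in [set` `[0, (1 : R)]%R] by apply/mem_set; rewrite /= in_itv /= t0.
have [y hy] := unit_ray hgamma (erefl (modulus (w n.+1))).
have [x hx] : exists x : E n, forall j, (j < n.+1)%N ->
    w j = ((Num.sqrt t)%:C)%C * join_coord x j.
  have [tz|tz] := eqVneq t 0.
    (* Any [x] serves when [t = 0]; the induction hypothesis at a basis vector supplies one. *)
    have [|x _] := ih (fun j => (j == 0%N)%:R).
      rewrite big_ord_recl big1 => [|j _]; first by rewrite addr0 /modulus normr1 expr1n.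
      by rewrite /modulus normr0 expr0n.
    exists x => j jn; rewrite tz sqrtr0 mul0r; apply/eqP.
    have /eqP := tz; rewrite /t psumr_eq0 => [|i _]; last exact: sqr_ge0.
    move=> /allP/(_ (Ordinal jn) (mem_index_enum _)); rewrite sqrf_eq0 => /eqP h.
    by rewrite -normr_eq0 modulusE h.
  have tp : 0 < t by rewrite lt_neqAle eq_sym tz.
  have [|x hx] := ih (fun j => (((Num.sqrt t)^-1)%:C)%C * w j).
    rewrite (eq_bigr (fun j : 'I_n.+1 => t^-1 * modulus (w j) ^+ 2)).
      by rewrite -mulr_sumr mulVf.
    by move=> j _; rewrite sqr_modulusM exprVn sqr_sqrtr.
  exists x => j jn; rewrite hx // mulrA -rmorphM mulfV ?mul1r //.
  by rewrite gt_eqF // sqrtr_gt0.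
exists (\pi_(join R (E n) (Gtranslate (circle R)))%qT (x, y, exist _ t tI : unit_itv R)).
move=> j jn; apply: etrans (join_coordS x y _ j) _; case: ifPn => [jn'|]; first by rewrite hx.
rewrite -leqNgt => jn'; have -> : j = n.+1 by apply/eqP; rewrite eqn_leq jn' andbT -ltnS.
by rewrite [RHS]hy /= s1 sqrtr_sqr ger0_norm ?modulus_ge0.
Qed.

Lemma join_coord_act n g (x : E n) j :
  join_coord (Gspace_act g x) j = gv g * join_coord x j.
Proof.
elim: n x j => [|n ih] x j; first by rewrite /= (gvM hgamma) mulrC.
rewrite [Gspace_act _ _]/= /join_act join_coordS /=; case: ifP => _.
  by rewrite ih mulrCA.
by rewrite (gvM hgamma) mulrA [RHS]mulrC.
Qed.

Lemma join_coord_continuous n j : continuous (fun x : E n => join_coord x j).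
Proof.
elim: n j => [|n ih] j; first exact: gv_continuous.
apply/(@quotient_continuous _ (join R (E n) (Gtranslate (circle R)))).
pose f (q : E n * circle R * unit_itv R) : C := if (j < n.+1)%N
  then ((Num.sqrt (\val q.2))%:C)%C * join_coord q.1.1 j
  else ((Num.sqrt (1 - \val q.2))%:C)%C * gv q.1.2.
have e : (fun x : E n.+1 => join_coord x j) \o
    \pi_(join R (E n) (Gtranslate (circle R)))%qT = f.
  by apply/funext => -[[x y] t]; exact: join_coordS.
suff : continuous f by rewrite -e.
rewrite /f; case: (j < n.+1)%N; apply: Cx_continuousM => q.
- by apply: (@cvg_comp _ _ _ snd (fun t : unit_itv R => ((Num.sqrt (\val t))%:C)%C : C));
    [exact: cvg_snd|exact: sqrt_itv_continuous].
- apply: (@cvg_comp _ _ _ (fun q : E n * circle R * unit_itv R => q.1.1)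
    (fun x : E n => join_coord x j)); last exact: ih.
  by apply: (@cvg_comp _ _ _ fst fst); exact: cvg_fst.
- apply: (@cvg_comp _ _ _ snd (fun t : unit_itv R => ((Num.sqrt (1 - \val t))%:C)%C : C)).
    exact: cvg_snd.
  apply: (@cvg_comp _ _ _ (fun t : unit_itv R => Num.sqrt (1 - \val t)) (fun t : R => (t%:C)%C : C)).
    apply: (@cvg_comp _ _ _ (fun t : unit_itv R => 1 - \val t) Num.sqrt _ (nbhs (1 - \val q.2 : R)));
      last exact: sqrt_continuous.
    by apply: cvgB; [exact: cvg_cst|exact: itv_val_continuous].
  exact: continuous_real_complex.
- apply: (@cvg_comp _ _ _ (fun q : E n * circle R * unit_itv R => q.1.2) (fun h => gv h)); last exact: gv_continuous.
  by apply: (@cvg_comp _ _ _ fst snd); [exact: cvg_fst|exact: cvg_snd].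
Qed.

Lemma compact_EG n : compact [set: E n].
Proof.
elim: n => [|n ih]; first exact: compact_circle.
have -> : [set: E n.+1] =
    (\pi_(join R (E n) (Gtranslate (circle R)))%qT) @` [set: E n * circle R * unit_itv R].
  apply/seteqP; split => // p _; exists (repr p) => //; exact: reprK.
apply: continuous_compact.
  by apply: continuous_subspaceT; exact: (@pi_continuous _ (join R (E n) (Gtranslate (circle R)))).
rewrite -!setXTT; apply: compact_setX; last exact: compact_unit_itv.
by apply: compact_setX => //; exact: compact_circle.
Qed.

Definition EG_coord n (x : E n) (j : 'I_n.+1) : C := join_coord x j.

Lemma EG_coord_bound n (x : E n) j : modulus (EG_coord x j) <= 1.
Proof.
rewrite -(@ler_pXn2r _ 2) ?nnegrE ?modulus_ge0 // expr1n -[X in _ <= X](join_coord_sqnorm x).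
by rewrite (bigD1 j) //= lerDl sumr_ge0 // => i _; exact: sqr_ge0.
Qed.

Lemma EG_admissible n (f : E n -> C) : Cont f -> admissible (@EG_coord n) f.
Proof.
move=> cf; apply: (compact_admissible (@compact_EG n) _ cf) => [j|p q e].
  exact: join_coord_continuous.
suff -> : p = q by [].
apply: join_coord_inj => j jn; exact: (congr1 (fun c => c (Ordinal jn)) e).
Qed.

Variables (A : cstarAlgType R) (alpha : cstar_action (circle R) A).

Lemma sphere_hom_of_normals n (a : 'I_n.+1 -> A) :
  (forall i, normal (a i)) -> (forall i j, commute (a i) (a j)) ->
  (forall i, spectral_subspace alpha gamma (a i)) ->
  \sum_i (a i * star (a i))%g = 1%g ->
  exists phi : (E n -> C) -> A,
    [/\ star_hom (@Cont R (E n)) phi, phi (fun=> 1) = 1%g &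
        equivariant (@Gspace_act (circle R) (E n)) (@Cont R (E n)) alpha phi].
Proof.
move=> na comm sa a1.
have comm_star := sphere_comm_star na a1 comm.
have na1 := sphere_norm_le1 na a1.
have full : fullness a (@EG_coord n).
  left; split => // w; rewrite /sqnorm => w1.
  have [|x hx] := @join_coord_surj n (fun j => w (inord j)).
    by rewrite -w1; apply: eq_bigr => j _; rewrite inord_val.
  by exists x; apply/funext => j; rewrite /EG_coord hx // inord_val.
exists (calculus (@EG_coord n) comm comm_star); split; first split.
- by move=> f g /EG_admissible af /EG_admissible ag; rewrite -calculusD.
- by move=> c f /EG_admissible af; rewrite -calculusZ.
- by move=> f g /EG_admissible af /EG_admissible ag; rewrite -calculusM //; exact: EG_coord_bound.
- by move=> f /EG_admissible af; rewrite -calculus_star.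
- exact: calculus1.
move=> g f /EG_admissible af.
rewrite -(@calculus_equivariant _ _ _ _ _ _ comm comm_star na1 full _ alpha
  (fun h => gv h) (@Gspace_act (circle R) (E n)) f) //.
- exact: (gvV hgamma).
- exact: gv_conj.
- by move=> h j; exact: sa.
- by move=> h x j; exact: join_coord_act.
Qed.

Lemma normals_of_sphere_hom n (phi : (E n -> C) -> A) :
  star_hom (@Cont R (E n)) phi -> phi (fun=> 1) = 1%g ->
  equivariant (@Gspace_act (circle R) (E n)) (@Cont R (E n)) alpha phi ->
  exists a : 'I_n.+1 -> A,
  [/\ forall i, normal (a i), forall i j, commute (a i) (a j),
      forall i, spectral_subspace alpha gamma (a i) &
      \sum_i (a i * star (a i))%g = 1%g].
Proof.
move=> hphi phi1 ephi; have [phiD phiZ phiM phiS] := hphi.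
pose z (i : 'I_n.+1) (x : E n) : C := join_coord x i.
have cz i : Cont (z i) by exact: join_coord_continuous.
have czc i : Cont (fun x => (z i x)^*).
  move=> x; apply: (@cvg_comp _ _ _ (z i) (fun c : C => c^*)); first exact: cz.
  exact: continuous_conj.
have h i := normal_of_hom hphi ephi (cz i) (czc i) (fun g x => join_coord_act g x i).
exists (fun i => phi (z i)); split.
- by move=> i; have [] := h i.
- move=> i j; rewrite /commute -!phiM //; congr (phi _).
  by apply/funext => x; rewrite mulrC.
- by move=> i; have [] := h i.
rewrite (eq_bigr (fun i => phi (fun x => z i x * (z i x)^*))) => [|i _]; last by have [] := h i.
have phi0 : phi (fun=> 0) = 0.
  have -> : (fun=> 0) = (fun x : E n => 0 * (fun=> 1) x :> C).
    by apply/funext => x; rewrite mul0r.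
  by rewrite phiZ ?scale0r // => x; exact: cvg_cst.
(* Additivity of [phi] holds on continuous functions only, so the induction carries the continuity
   of the partial sums along. *)
have phi_sum (r : seq 'I_n.+1) : Cont (fun x => \sum_(i <- r) z i x * (z i x)^*) /\
    \sum_(i <- r) phi (fun x => z i x * (z i x)^*) =
    phi (fun x => \sum_(i <- r) z i x * (z i x)^*).
  elim: r => [|i r [ic ih]].
    rewrite big_nil (_ : (fun=> _) = (fun=> 0)); last by apply/funext => x; rewrite big_nil.
    by rewrite phi0; split => // x; exact: cvg_cst.
  rewrite big_cons (_ : (fun=> _) = (fun x => z i x * (z i x)^* + \sum_(j <- r) z j x * (z j x)^*)).
    have c1 : Cont (fun x => z i x * (z i x)^*) by exact: Cx_continuousM (cz i) (czc i).
    split; last by rewrite ih -(phiD _ _ c1 ic).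
    by move=> x; apply: cvgD; [exact: c1|exact: ic].
  by apply/funext => x; rewrite big_cons.
have [_ ->] := phi_sum (index_enum _); rewrite -phi1; congr (phi _); apply/funext => x.
rewrite -(rmorph1 (@real_complex R)) -(join_coord_sqnorm x) rmorph_sum.
by apply: eq_bigr => i _; rewrite -normCK modulusE -rmorphXn.
Qed.

End JoinCoordinates.

(** * From single homomorphisms to the three dimensions *)

Lemma invertibleZ (R : realType) (A : cstarAlgType R) (c : Cx R) (x : A) :
  c != 0 -> invertible x -> invertible (c *: x).
Proof.
move=> c0 [y [yx xy]]; exists (c^-1 *: y).
by rewrite -!cscaleAl -!cscaleAr !scalerA mulVf // mulfV // !scale1r.
Qed.

Lemma cone_homs_of_normals (R : realType) (A : cstarAlgType R)
    (alpha : cstar_action (circle R) A) (gamma : circle R -> circle R) n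
    (a : 'I_n.+1 -> A) : dual_generator gamma ->
  (forall i, normal (a i)) -> (forall i, spectral_subspace alpha gamma (a i)) ->
  (forall i, anorm (a i) <= 1) ->
  exists rho : 'I_n.+1 -> (half_open R * circle R -> Cx R) -> A,
    (forall i, cone_hom alpha (rho i)) /\
    \sum_i rho i (@cone_t R (circle R)) = \sum_i (a i * star (a i))%g.
Proof.
move=> hg na sa a1.
have /choice[rho hrho] i : exists rho, cone_hom alpha rho /\
    rho (@cone_t R (circle R)) = (a i * star (a i))%g.
  by have [rho h1 h2] := cone_hom_of_normal hg (na i) (sa i) (a1 i); exists rho.
exists rho; split=> [i|]; first by have [] := hrho i.
by apply: eq_bigr => i _; have [] := hrho i.
Qed.

Lemma normals_of_cone_homs (R : realType) (A : cstarAlgType R)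
    (alpha : cstar_action (circle R) A) (gamma : circle R -> circle R) n
    (rho : 'I_n.+1 -> (half_open R * circle R -> Cx R) -> A) : dual_generator gamma ->
  (forall i, cone_hom alpha (rho i)) ->
  exists a : 'I_n.+1 -> A,
  [/\ forall i, normal (a i), forall i, spectral_subspace alpha gamma (a i) &
      \sum_i (a i * star (a i))%g = \sum_i rho i (@cone_t R (circle R))].
Proof.
move=> hg hrho.
have /choice[a ha] i := normal_of_cone_hom hg (hrho i).
exists a; split=> [i|i|]; try by have [] := ha i.
by apply: eq_bigr => i _; have [] := ha i.
Qed.

Theorem proposition3p1 (R : realType) (A : cstarAlgType R)
    (alpha : cstar_action (circle R) A) (gamma : circle R -> circle R)
    (hgamma : dual_generator gamma) :
  [/\ dim_LT alpha = min_set [set n : nat |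
        exists a : 'I_n.+1 -> A,
          [/\ forall i, normal (a i),
              forall i, spectral_subspace alpha gamma (a i) &
              \sum_i (a i * star (a i))%g = 1%g]],
      dim_WLT alpha = min_set [set n : nat |
        exists a : 'I_n.+1 -> A,
          [/\ forall i, normal (a i),
              forall i, spectral_subspace alpha gamma (a i) &
              invertible (\sum_i (a i * star (a i))%g)]] &
      dim_SLT alpha = min_set [set n : nat |
        exists a : 'I_n.+1 -> A,
          [/\ forall i, normal (a i),
              forall i j, commute (a i) (a j),
              forall i, spectral_subspace alpha gamma (a i) &
              \sum_i (a i * star (a i))%g = 1%g]]].
Proof.
split; congr min_set; apply/seteqP; split=> n /=.
- move=> [rho [hrho r1]]; have [a [na sa e]] := normals_of_cone_homs hgamma hrho.
  by exists a; split=> //; rewrite e.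
- move=> [a [na sa a1]].
  have [rho [hrho e]] := cone_homs_of_normals hgamma na sa (sphere_norm_le1 na a1).
  by exists rho; split=> //; rewrite e.
- move=> [rho [hrho r1]]; have [a [na sa e]] := normals_of_cone_homs hgamma hrho.
  by exists a; split=> //; rewrite e.
- move=> [a [na sa a1]].
  (* The calculus on the disc requires contractions, and invertibility of the sum does not bound the
     [a i]. Dividing all of them by the common [s] stays in the spectral subspace and multiplies the
     sum by a nonzero scalar. *)
  pose s : R := 1 + \sum_i anorm (a i).
  have s0 : 0 < s.
    by apply: ltr_pwDl => //; apply: sumr_ge0 => i _; exact: anorm_ge0.
  pose c : Cx R := ((s^-1)%:C)%C.
  have c0 : c != 0.
    by rewrite -normr_eq0 modulusE modulus_real ger0_norm ?invr_ge0 ?(ltW s0) //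
      fmorph_eq0 invr_eq0 gt_eqF.
  have cc : c^* = c by exact: conj_real_complex.
  have ca i : (c *: a i * star (c *: a i))%g = (c * c) *: (a i * star (a i))%g.
    by rewrite starZ cc -cscaleAl -cscaleAr scalerA.
  have [|||rho [hrho e]] := @cone_homs_of_normals _ _ alpha gamma n (fun i => c *: a i) hgamma.
  + by move=> i; rewrite /normal ca starZ cc -cscaleAl -cscaleAr scalerA na.
  + by move=> i g; rewrite act_scale (sa i) !scalerA mulrC.
  + move=> i; rewrite anormZ modulus_real ger0_norm ?invr_ge0 ?(ltW s0) //.
    rewrite ler_pdivrMl // mulr1 /s (bigD1 i) //= addrCA lerDl addr_ge0 //.
    by apply: sumr_ge0 => j _; exact: anorm_ge0.
  exists rho; split=> //; rewrite e (eq_bigr _ (fun i _ => ca i)) -scaler_sumr.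
  by apply: invertibleZ => //; rewrite mulf_neq0.
- move=> [phi [h1 h2 h3]]; exact: (normals_of_sphere_hom hgamma h1 h2 h3).
- move=> [a [na comm sa a1]]; exact: (sphere_hom_of_normals hgamma na comm sa a1).
Qed.
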